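(* Let $d\ge 3$. Any toroidal $d$-angulation of essential girth $d$ admits a balanced $\frac{d}{d-2}$-orientation.
   Context: A toroidal map is an embedding of a connected graph (loops and multiple edges allowed) on the torus such that every connected component of the complement (face) is homeomorphic to an open disk. The degree of a face is the number of its corners (equivalently of incident edge-sides). A toroidal $d$-angulation is a toroidal map all of whose faces have degree $d$. A cycle is a closed walk with no repeated vertices; the girth of a (possibly infinite) map is the length of a shortest cycle. The essential girth of a toroidal map $M$ is the girth of its universal cover $M^\infty$ (the periodic planar map obtained by lifting $M$ to the plane). $\mathbb{N}$ contains $0$. An $\mathbb{N}$-biorientation of a map is an assignment of a weight in $\mathbb{N}$ to every half-edge (a half-edge is called outgoing at its incident vertex if its weight is positive, and ingoing if its weight is $0$). The weight of a vertex is the sum of the weights of its incident half-edges; the weight of an edge is the sum of the weights of its two half-edges. A $\frac{d}{d-2}$-orientation of a toroidal $d$-angulation is an $\mathbb{N}$-biorientation in which every vertex has weight $d$ and every edge has weight $d-2$. For a non-contractible cycle $C$ with a traversal direction, let $\gamma_R(C)$ (resp. $\gamma_L(C)$) be the total weight of the half-edges not on $C$ that are incident to a vertex of $C$ on the right (resp. left) side of $C$, and let $\gamma(C)=\gamma_R(C)-\gamma_L(C)$ (the $\gamma$-score). An $\mathbb{N}$-biorientation of a toroidal map is balanced if $\gamma(C)=0$ for every non-contractible cycle $C$. *)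

(* Defs.v *)
From Stdlib Require Import Relation_Operators.
From mathcomp Require Import all_boot ssralg ssrint.
From mathcomp Require Import boolp classical_sets.

Set Implicit Arguments.
Unset Strict Implicit.
Unset Printing Implicit Defensive.

(* A possibly infinite map on an oriented surface, given by its half-edges     *)
(* (darts): edge exchanges the two half-edges of an edge, and next is the      *)
(* counterclockwise rotation around the vertex to which a half-edge is         *)
(* incident. A dart is also read as its edge traversed away from that vertex.  *)
Record cmap (D : eqType) := CMap {
  edge : D -> D;
  next : D -> D;
  edgeK : involutive edge;
  edge_neq : forall x, edge x != x;
  next_bij : bijective next }.

Section Maps.
Variables (D : eqType) (M : cmap D).
Implicit Types (x y : D) (u v s c : seq D).

(* Vertices are the orbits of next. *)
Definition same_vertex x y : bool :=
  `[< clos_refl_sym_trans D (fun a b => next M a = b) x y >].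

(* Faces are the orbits of face: x and face x are consecutive sides of the     *)
(* face lying to the right of x.                                               *)
Definition face x := next M (edge M x).

Definition consecutive x y := same_vertex (edge M x) y.

(* u is a walk starting at the vertex of x (as edge (edge x) = x). *)
Definition walk x u := path consecutive (edge M x) u.

(* Some dart at the final vertex of a walk u starting at the vertex of x. *)
Definition walk_end x u := edge M (last (edge M x) u).

(* The third condition bears on edges and only matters when size c = 2: it     *)
(* excludes traversing a single edge back and forth.                           *)
Definition is_cycle c : bool :=
  [&& c != [::], cycle consecutive c, all (fun x => edge M x \notin c) c
    & pairwise (fun x y => ~~ same_vertex x y) c].

Definition has_girth (g : nat) : Prop :=
  (exists2 c, is_cycle c & size c = g) /\ (forall c, is_cycle c -> g <= size c).

(* Homotopy, with fixed endpoints, of walks starting at the vertex of x:       *)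
(* generated by the deletion of a backtrack or of a complete face contour.     *)
Definition null_factor s : Prop :=
  (exists y, s = [:: y; edge M y]) \/
  (exists y n, iter n face y = y /\ s = traject face y n).

Definition homotopy_step x u v : Prop :=
  exists s1 s s2,
    [/\ u = s1 ++ s ++ s2, v = s1 ++ s2, walk x u & null_factor s].

Definition homotopic x : seq D -> seq D -> Prop :=
  clos_refl_sym_trans (seq D) (homotopy_step x).

Definition contractible c : Prop :=
  if c is x :: _ then homotopic x c [::] else True.

Lemma same_vertex_refl x : same_vertex x x.
Proof. exact/asboolP/rst_refl. Qed.

Lemma same_vertex_sym x y : same_vertex x y = same_vertex y x.
Proof. by apply/asboolP/asboolP; apply: rst_sym. Qed.

Lemma same_vertex_trans y x z :
  same_vertex x y -> same_vertex y z -> same_vertex x z.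
Proof. move=> /asboolP xy /asboolP yz; apply/asboolP; exact: rst_trans xy yz. Qed.

Lemma same_vertex_next x : same_vertex x (next M x).
Proof. exact/asboolP/rst_step. Qed.

Lemma walk_cat x u v : walk x (u ++ v) = walk x u && walk (walk_end x u) v.
Proof. by rewrite /walk cat_path /walk_end edgeK. Qed.

Lemma walk_endcat x u v : walk_end x (u ++ v) = walk_end (walk_end x u) v.
Proof. by rewrite /walk_end last_cat edgeK. Qed.

Lemma walk_rcons x u y :
  walk x (rcons u y) = walk x u && same_vertex (walk_end x u) y.
Proof. by rewrite -cats1 walk_cat /walk /= andbT /consecutive edgeK. Qed.

Lemma walk_end_rcons x u y : walk_end x (rcons u y) = edge M y.
Proof. by rewrite /walk_end last_rcons. Qed.

Lemma walk_vertex x y u : same_vertex x y -> walk x u = walk y u.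
Proof.
move=> xy; case: u => // z u; rewrite /walk /= /consecutive !edgeK.
congr andb; apply/idP/idP; first by apply: same_vertex_trans; rewrite same_vertex_sym.
exact: same_vertex_trans.
Qed.

Lemma walk_end_vertex x y u :
  same_vertex x y -> same_vertex (walk_end x u) (walk_end y u).
Proof.
by case: u => [|z u] xy; rewrite /walk_end /= ?edgeK // same_vertex_refl.
Qed.

Lemma null_factor_end x s :
  null_factor s -> walk x s -> same_vertex (walk_end x s) x.
Proof.
case=> [[y ->]|[y [n [yn ->]]]]; rewrite /walk /walk_end /=.
  by case/andP; rewrite /consecutive !edgeK same_vertex_sym.
case: n yn => [|n] yn /=; first by rewrite !edgeK same_vertex_refl.
case/andP; rewrite /consecutive edgeK same_vertex_sym => xy _.
rewrite (last_traject face); apply: (same_vertex_trans _ xy).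
by rewrite -[X in same_vertex _ X]yn /= /face same_vertex_next.
Qed.

Lemma homotopy_step_walk x u v : homotopy_step x u v ->
  [/\ walk x u, walk x v & same_vertex (walk_end x u) (walk_end x v)].
Proof.
case=> s1 [s [s2 [-> -> wu ns]]]; rewrite wu !walk_endcat.
move: wu; rewrite !walk_cat => /and3P[-> ws ws2].
have e := null_factor_end ns ws.
by rewrite -(walk_vertex _ e) ws2; split=> //; apply: walk_end_vertex.
Qed.

Lemma homotopic_walk x u v : homotopic x u v -> walk x u ->
  walk x v /\ same_vertex (walk_end x u) (walk_end x v).
Proof.
move=> h; suff [<- e] : walk x u = walk x v /\
  (walk x u -> same_vertex (walk_end x u) (walk_end x v)) by split=> //; exact: e.
elim: h => {u v} [u v /homotopy_step_walk[-> -> ->]//|u|u v _ [-> e]|].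
- by rewrite same_vertex_refl.
- by rewrite same_vertex_sym.
- move=> u v t _ [e1 uv] _ [e2 vt]; split; first by rewrite e1.
  by move=> wu; apply: same_vertex_trans (uv wu) (vt _); rewrite -e1.
Qed.

Lemma homotopic_rcons x u v y : homotopic x u v -> walk x (rcons u y) ->
  homotopic x (rcons u y) (rcons v y).
Proof.
move=> h; rewrite walk_rcons => /andP[wu]; elim: h wu => {u v}.
- move=> u v [s1 [s [s2 [-> -> wu ns]]]] _ e; apply: rst_step.
  exists s1, s, (rcons s2 y); rewrite !rcons_cat; split=> //.
  by rewrite -!rcons_cat walk_rcons wu.
- by move=> u _ _; apply: rst_refl.
- move=> u v h IH wv e; have [wu uv] := homotopic_walk (rst_sym _ _ _ _ h) wv.
  apply: rst_sym; apply: (IH wu); move: e; apply: same_vertex_trans.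
  by rewrite same_vertex_sym.
- move=> u v t h IH _ IH' wu e; have [wv uv] := homotopic_walk h wu.
  apply: rst_trans (IH wu e) _; apply: (IH' wv); move: e.
  by apply: same_vertex_trans; rewrite same_vertex_sym.
Qed.

End Maps.

Section UniversalCover.
Variables (D : eqType) (M : cmap D) (x0 : D).

Definition homotopy_class (u : seq D) : set (seq D) :=
  [set v | homotopic M x0 u v]%classic.

(* The vertices of the universal cover are the homotopy classes of walks from  *)
(* the vertex of x0; its half-edges are the pairs of such a class and a        *)
(* half-edge at the common endpoint of the walks in the class.                 *)
Definition is_cover_dart (p : set (seq D) * D) : Prop :=
  exists u, [/\ walk M x0 u, same_vertex M (walk_end M x0 u) p.2
              & p.1 = homotopy_class u].

Definition cover_dart := {p : set (seq D) * D | `[< is_cover_dart p >]}.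

Definition cover_edge_pair (p : set (seq D) * D) : set (seq D) * D :=
  ([set v | exists2 u, p.1 u & homotopic M x0 (rcons u p.2) v]%classic,
   edge M p.2).

Definition cover_next_pair (p : set (seq D) * D) : set (seq D) * D :=
  (p.1, next M p.2).

Lemma cover_edge_class u x : walk M x0 (rcons u x) ->
  (cover_edge_pair (homotopy_class u, x)).1 = homotopy_class (rcons u x).
Proof.
move=> wux; apply/seteqP; split=> v /=; last by exists u => //; apply: rst_refl.
by case=> u' uu'; apply: rst_trans; apply: homotopic_rcons.
Qed.

Lemma cover_edge_subproof (p : cover_dart) :
  `[< is_cover_dart (cover_edge_pair (val p)) >].
Proof.
case: p => -[C x] /= /asboolP[u [/= wu ux ->]]; apply/asboolP.
have wux : walk M x0 (rcons u x) by rewrite walk_rcons wu.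
exists (rcons u x); split=> //; last exact: cover_edge_class.
by rewrite walk_end_rcons same_vertex_refl.
Qed.

Lemma cover_next_subproof (p : cover_dart) :
  `[< is_cover_dart (cover_next_pair (val p)) >].
Proof.
case: p => -[C x] /= /asboolP[u [/= wu ux ->]]; apply/asboolP.
exists u; split=> //; exact: same_vertex_trans ux (same_vertex_next M x).
Qed.

Definition cover_edge (p : cover_dart) : cover_dart :=
  Sub (cover_edge_pair (val p)) (cover_edge_subproof p).

Definition cover_next (p : cover_dart) : cover_dart :=
  Sub (cover_next_pair (val p)) (cover_next_subproof p).

Lemma cover_edgeK : involutive cover_edge.
Proof.
move=> p; apply: val_inj; case: p => -[C x] /= /asboolP[u [/= wu ux ->]].
have wux : walk M x0 (rcons u x) by rewrite walk_rcons wu.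
have wuxx : walk M x0 (rcons (rcons u x) (edge M x)).
  by rewrite walk_rcons wux walk_end_rcons same_vertex_refl.
rewrite [X in cover_edge_pair X]surjective_pairing cover_edge_class //=.
rewrite [LHS]surjective_pairing cover_edge_class //= edgeK; congr pair.
have h : homotopic M x0 (rcons (rcons u x) (edge M x)) u.
  apply: rst_step; exists u, [:: x; edge M x], [::].
  by rewrite wuxx !cats0 -!cats1 -catA; split=> //; left; exists x.
apply/seteqP; split=> v; apply: rst_trans => //; exact: rst_sym.
Qed.

Lemma cover_edge_neq p : cover_edge p != p.
Proof.
by apply/eqP => /(congr1 (fun q => (val q).2)) /eqP; rewrite /= (negbTE (edge_neq _ _)).
Qed.

Lemma cover_next_bij : bijective cover_next.
Proof.
have [g nK gK] := next_bij M.
have gP (p : cover_dart) : `[< is_cover_dart ((val p).1, g (val p).2) >].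
  case: p => -[C x] /= /asboolP[u [/= wu ux ->]]; apply/asboolP.
  exists u; split=> //; apply: same_vertex_trans ux _ => /=.
  by rewrite -{1}[x]gK same_vertex_sym same_vertex_next.
exists (fun p => Sub ((val p).1, g (val p).2) (gP p) : cover_dart).
  by move=> p; apply: val_inj; rewrite /= nK -surjective_pairing.
by move=> p; apply: val_inj; rewrite /= /cover_next_pair /= gK -surjective_pairing.
Qed.

Definition universal_cover : cmap cover_dart :=
  CMap cover_edgeK cover_edge_neq cover_next_bij.

End UniversalCover.

Definition has_essential_girth (D : eqType) (M : cmap D) (g : nat) : Prop :=
  exists x0 : D, has_girth (universal_cover M x0) g.

Section FiniteMaps.
Variables (D : finType) (M : cmap D).

(* Nonempty, connected, and of Euler characteristic 0. A map without edges is  *)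
(* never cellular on the torus.                                                *)
Definition toroidal : Prop :=
  [/\ 0 < #|D|,
      forall x y : D, connect [rel a b | (b == edge M a) || (b == next M a)] x y
    & fcard (next M) D + fcard (face M) D = fcard (edge M) D].

Definition angulation (d : nat) : Prop := forall x : D, order (face M) x = d.

Variable w : D -> nat.

Definition vertex_weight (x : D) : nat := \sum_(y | same_vertex M x y) w y.

Definition edge_weight (x : D) : nat := w x + w (edge M x).

Definition orientation_d_dm2 (d : nat) : Prop :=
  (forall x, vertex_weight x = d) /\ (forall x, edge_weight x = d - 2).

(* The half-edges strictly between x and y, counterclockwise from x, for x and *)
(* y incident to the same vertex.                                              *)
Definition sector (x y : D) : seq D :=
  behead (traject (next M) x (findex (next M) x y)).

(* At the vertex of the dart x of a cycle c, the half-edges on c are x and     *)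
(* edge (prev c x): c enters through the latter and leaves through x.          *)
Definition gamma_R (c : seq D) : nat :=
  \sum_(x <- c) \sum_(y <- sector (edge M (prev c x)) x) w y.

Definition gamma_L (c : seq D) : nat :=
  \sum_(x <- c) \sum_(y <- sector x (edge M (prev c x))) w y.

Definition gamma (c : seq D) : int := ((gamma_R c)%:Z - (gamma_L c)%:Z)%R.

Definition balanced : Prop :=
  forall c, is_cycle M c -> ~ contractible M c -> gamma c = 0%R.

End FiniteMaps.

(* Main.v *)
From Stdlib Require Import Relation_Operators.
From mathcomp Require Import boolp classical_sets.
From mathcomp Require Import all_boot fingroup perm order ssralg ssrint ssrnum.
From mathcomp Require Import zify.
Require Import Defs.

Set Implicit Arguments.
Unset Strict Implicit.
Unset Printing Implicit Defensive.

Import Order.TTheory GRing.Theory Num.Theory.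

(** The darts weighted by w carry a discrete geometry in which the wanted
    orientation is a flat one, and the proof is a discrete form of the theorem
    on turning tangents on the torus.

    Contours. For a set S of edges, the boundary walks of the ribbon subgraph
    with all vertices and the edges of S are the cycles of contour_next S: at
    a dart off S one turns past it, at a dart on S one follows it. The turning
    of a contour is the sum of the weights of the darts it turns past, minus
    the number of darts it follows. When every vertex has weight d and every
    edge has weight d - 2, the contour of a bare vertex has turning d, the
    contour of a face has turning -d, and adding an edge to S, whether it
    merges two contours or splits one, lowers the sum of all turnings by d
    (turning_merge). This is Gauss-Bonnet, one edge at a time. The number of
    merges still to come when the missing edges are added is the level of S;
    it is the Euler characteristic of the torus that makes it independent of
    the order (levelE). Level 0 means that the complement of the ribbon
    subgraph consists of discs; connected subgraphs have level 0 or 1. Along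
    the induction on edges, null-homotopy of contours is followed together
    with turning, so that contours around trees and discs are known to have
    turning d and -d and to be null-homotopic.

    The ribbon subgraph of a cycle C has as contours, besides the remaining
    vertices, the right and the left side of C, and the right one has turning gamma_R C minus the length of C
    (right_contour_turning). Since gamma_R C + gamma_L C is twice this length
    (gamma_sum), C is balanced as soon as both contours have nonnegative
    turning. So it suffices to find natural weights for which every such
    contour has nonnegative turning or is null-homotopic.

    Integer weights. Allow weights of any sign first. If T is a spanning tree
    and a another edge, T + a has one cycle, and it is essential if some
    further edge joins its two contours; T is vanishing if the turnings on T +
    a are 0 for all such a. Two crossing fundamental cycles can be given
    turning 0 by moving weight between the two darts of one edge each, after
    which a flow along T restores the weights of the vertices
    (exists_weights). These two cycles generate the homology of the torus, and
    turning is additive enough for the others to follow: for cycles that do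
    not cross by planar_theta, for three pairwise crossing ones by hexagon,
    and then for all spanning trees by exchanging one edge at a time
    (vanishing_all). It follows that a contour met by every edge of S has
    nonnegative turning, or has turning -d and is null-homotopic
    (contour_nonneg_or_disc): connect S by absorbing trees into contours,
    absorb discs, and end with a tree, or with a tree plus one edge.

    Natural weights. Adding to w the coboundary of an integer function on the
    faces changes no turning. If no such change reduces the negative part of
    w, there is a simple closed path in the darts, passing darts of weight at
    most 0, one of them negative, and following faces in between. Such a path
    is a contour, and its turning is less than minus the number of darts
    followed; so it has turning -d and is null-homotopic, and it follows fewer
    than d darts. This is where the essential girth comes in: a null-homotopic
    walk of fewer than d darts has a backtrack, so by pruning spurs the
    contour is that of a tree and has turning d, a contradiction
    (no_negative_cycle). *)

(** * Cycles of a permutation *)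

Lemma mem_porbit_fconnect (D : finType) (s : {perm D}) x y :
  (y \in porbit s x) = fconnect s x y.
Proof.
apply/porbitP/idP => [[i ->]|/iter_findex <-]; first by rewrite permX fconnect_iter.
by exists (findex s x y); rewrite permX.
Qed.

Lemma fcard_porbits (D : finType) (s : {perm D}) : fcard s D = #|porbits s|.
Proof.
have sym := fconnect_sym (@perm_inj _ s).
rewrite /n_comp_mem -(card_in_imset (f := porbit s)).
  apply: eq_card => A; apply/imsetP/imsetP => [[x _ ->]|[x _ ->]]; first by exists x.
  exists (root (frel s) x); first by rewrite inE /= roots_root.
  apply/eqP; rewrite eq_porbit_mem porbit_sym mem_porbit_fconnect.
  exact: (connect_root (frel s)).
move=> x y; rewrite !inE !andbT => /eqP rx /eqP ry /eqP.
by rewrite eq_porbit_mem mem_porbit_fconnect -(root_connect sym) ry rx => /eqP.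
Qed.

(** * Edge sets and their contours *)

Section Contours.
Variables (D : finType) (M : cmap D).
Notation N := (next M).
Notation e := (edge M).

Lemma next_inj : injective N. Proof. exact: bij_inj (next_bij M). Qed.
Lemma edge_inj : injective e. Proof. exact: inv_inj (edgeK M). Qed.
Lemma face_inj : injective (face M). Proof. by move=> x y /next_inj /edge_inj. Qed.

Definition edge_closed (S : {set D}) := [forall h, (e h \in S) == (h \in S)].
Definition edge_set := {S : {set D} | edge_closed S}.
Implicit Types S T : edge_set.

Definition on S h := h \in val S.

Lemma onE S h : on S (e h) = on S h.
Proof. by have /forallP/(_ h)/eqP := valP S. Qed.

Lemma edge_set_ext S T : on S =1 on T -> S = T.
Proof. by move=> ST; apply/val_inj/setP. Qed.

Definition toggle_set S y : {set D} := [set h | on S h (+) ((h == y) || (h == e y))].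

Lemma edge_eqC x y : (e x == y) = (x == e y).
Proof. by apply/eqP/eqP => [<-|->]; rewrite edgeK. Qed.

Lemma toggle_closed S y : edge_closed (toggle_set S y).
Proof.
apply/forallP=> h; rewrite !inE onE !edge_eqC edgeK.
by rewrite [(_ == e y) || _]orbC.
Qed.

Definition toggle S y : edge_set := Sub (toggle_set S y) (toggle_closed S y).

Lemma on_toggle S y h : on (toggle S y) h = on S h (+) ((h == y) || (h == e y)).
Proof. by rewrite /on /= inE. Qed.

Lemma toggleK S y : toggle (toggle S y) y = S.
Proof. by apply: edge_set_ext => h; rewrite !on_toggle addbK. Qed.

Lemma toggle_edge S y : toggle S (e y) = toggle S y.
Proof. by apply: edge_set_ext => h; rewrite !on_toggle edgeK orbC. Qed.

Lemma toggleC S x y : toggle (toggle S x) y = toggle (toggle S y) x.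
Proof. by apply: edge_set_ext => h; rewrite !on_toggle -!addbA; congr addb; rewrite addbC. Qed.

Lemma toggle_self S y : on (toggle S y) y = ~~ on S y.
Proof. by rewrite on_toggle eqxx addbT. Qed.

Lemma card_toggle S y : ~~ on S y -> #|val (toggle S y)| = #|val S|.+2.
Proof.
move=> yS; have -> : val (toggle S y) = y |: (e y |: val S).
  apply/setP=> h; have -> : (h \in val (toggle S y)) = on (toggle S y) h by [].
  rewrite on_toggle !in_setU1 -/(on S h).
  by case: eqP => [->|_]; rewrite ?(negbTE yS) //=; case: eqP => [->|_];
    rewrite ?onE ?(negbTE yS) ?addbF.
rewrite !cardsU1 in_setU1 -!/(on S _) onE (negbTE yS) orbF eq_sym.
by rewrite edge_neq.
Qed.

Lemma empty_closed : edge_closed set0.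
Proof. by apply/forallP=> h; rewrite !inE. Qed.
Lemma full_closed : edge_closed setT.
Proof. by apply/forallP=> h; rewrite !inE. Qed.
Definition no_edge : edge_set := Sub set0 empty_closed.
Definition all_edge : edge_set := Sub setT full_closed.

Lemma on0 h : on no_edge h = false. Proof. by rewrite /on /= inE. Qed.
Lemma onT h : on all_edge h. Proof. by rewrite /on /= inE. Qed.

(** The boundary walk of the ribbon graph of S. A dart on S is traversed, to
    the corner that the face on its right has at its other end; a dart off S
    is passed in the rotation around its vertex. With no edge these are the
    vertices, with all edges the faces. *)
Definition contour_next S h := N (if on S h then e h else h).

Lemma contour_next_on S h : on S h -> contour_next S h = face M h.
Proof. by rewrite /contour_next => ->. Qed.
Lemma contour_next_off S h : ~~ on S h -> contour_next S h = N h.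
Proof. by rewrite /contour_next => /negbTE->. Qed.

Lemma contour_next_inj S : injective (contour_next S).
Proof.
move=> x y /next_inj; case: (boolP (on S x)) (boolP (on S y)) => xS [] yS //.
- exact: edge_inj.
- by move=> xy; move: yS; rewrite -xy onE xS.
- by move=> xy; move: xS; rewrite xy onE yS.
Qed.

(** Toggling an edge composes contour_next with one transposition; hence it
    merges two cycles or splits one, and the number of contours changes by
    one. *)
Lemma contour_next_toggle S y h :
  contour_next (toggle S y) h = contour_next S (tperm y (e y) h).
Proof.
rewrite /contour_next on_toggle; case: tpermP => [->|->|/eqP/negbTE-> /eqP/negbTE->].
- by rewrite eqxx onE edgeK; case: (on S y).
- by rewrite eqxx orbT onE edgeK; case: (on S y).
- by rewrite addbF.
Qed.

Definition same S x y := fconnect (contour_next S) x y.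
Definition contour S x := orbit (contour_next S) x.
Definition ncontours S := fcard (contour_next S) D.

Lemma same_refl S x : same S x x. Proof. exact: connect0. Qed.
Lemma sameC S x y : same S x y = same S y x.
Proof. exact: (fconnect_sym (@contour_next_inj S)). Qed.
Lemma same_trans S : transitive (same S).
Proof. by move=> x y z; apply: connect_trans. Qed.
Lemma same_l S x y : same S x y -> same S x =1 same S y.
Proof. by move=> xy; apply: (same_connect (fconnect_sym (@contour_next_inj S))). Qed.
Lemma same_r S x y z : same S x y -> same S z x = same S z y.
Proof. by move=> xy; rewrite ![same S z _]sameC; apply: same_l. Qed.
Lemma same_next S x : same S x (contour_next S x). Proof. exact: fconnect1. Qed.
Lemma mem_contour S x y : (y \in contour S x) = same S x y.
Proof. by rewrite /contour -fconnect_orbit. Qed.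

Lemma ncontours_gt1P S : reflect (exists x y, ~~ same S x y) (1 < ncontours S).
Proof.
apply: (iffP (fcard_gt1P (@contour_next_inj S) _)) => //.
  by case=> x _ [y _ xy]; exists x, y.
by case=> x [y xy]; exists x => //; exists y.
Qed.

Lemma ncontours_perm S : ncontours S = #|porbits (perm (@contour_next_inj S))|.
Proof. by rewrite -fcard_porbits; apply: eq_fcard => x; rewrite permE. Qed.

Lemma same_perm S x y : same S x y = (y \in porbit (perm (@contour_next_inj S)) x).
Proof. by rewrite mem_porbit_fconnect; apply: eq_fconnect => z; rewrite permE. Qed.

Lemma ncontours_toggle S y :
  (ncontours (toggle S y) + (~~ same S y (e y)).*2 = (ncontours S).+1)%N.
Proof.
rewrite -addn1 !ncontours_perm same_perm.
have -> : perm (@contour_next_inj (toggle S y)) = (tperm y (e y) * perm (@contour_next_inj S))%g.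
  by apply/permP=> h; rewrite permM permE contour_next_toggle permE.
have := porbits_mul_tperm (perm (@contour_next_inj S)) y (e y).
by rewrite [y == _]eq_sym edge_neq porbit_sym.
Qed.

Lemma ncontours_merge S y : ~~ same S y (e y) -> ncontours S = (ncontours (toggle S y)).+1.
Proof. by have := ncontours_toggle S y => + h; rewrite h /=; lia. Qed.

Lemma ncontours_split S y : same S y (e y) -> ncontours (toggle S y) = (ncontours S).+1.
Proof. by have := ncontours_toggle S y => + h; rewrite h /=; lia. Qed.

(** Contours as explicit cyclic lists, so that a toggle can be described as
    cutting and pasting of lists. *)
Definition is_contour S (L : seq D) := uniq L && fcycle (contour_next S) L.

Lemma is_contour_contour S x : is_contour S (contour S x).
Proof. by rewrite /is_contour orbit_uniq cycle_orbit //; apply: contour_next_inj. Qed.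

Lemma is_contour_same S L x y : is_contour S L -> x \in L ->
  same S x y = (y \in L).
Proof. by case/andP=> uL cL xL; rewrite -(fconnect_cycle cL xL). Qed.

Lemma contour_rot S L x : is_contour S L -> x \in L ->
  contour S x = rot (index x L) L.
Proof. by case/andP=> uL cL xL; rewrite /contour (orbitE cL). Qed.

Lemma contour_cons S x L : is_contour S (x :: L) -> contour S x = x :: L.
Proof. by move=> cL; rewrite (contour_rot cL) ?mem_head //= eqxx rot0. Qed.

Lemma is_contour_rot S n L : is_contour S (rot n L) = is_contour S L.
Proof. by rewrite /is_contour rot_uniq rot_cycle. Qed.

Lemma contourE S x : exists L, contour S x = x :: L.
Proof.
rewrite /contour /orbit -orderSpred /=; by eexists.
Qed.

Lemma path_toggle S y x z L : x = y \/ x = e y -> y \notin L -> e y \notin L ->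
  fpath (contour_next S) x (rcons L z) ->
  fpath (contour_next (toggle S y)) (e x) (rcons L z).
Proof.
move=> xy; have tx : contour_next (toggle S y) (e x) = contour_next S x.
  by case: xy => ->; rewrite contour_next_toggle ?edgeK ?tpermL ?tpermR.
have other h : h != y -> h != e y -> contour_next (toggle S y) h = contour_next S h.
  by move=> hy hey; rewrite contour_next_toggle tpermD // eq_sym.
have main h K : y \notin K -> e y \notin K -> h != y -> h != e y ->
    fpath (contour_next S) h (rcons K z) -> fpath (contour_next (toggle S y)) h (rcons K z).
  elim: K h => [|k K IH] h /=; first by move=> *; rewrite other.
  rewrite !inE !negb_or => /andP[yk yK] /andP[eyk eyK] hy hey /andP[hk kK].
  by rewrite other // hk IH // eq_sym.
case: L => [|k K] /=; first by rewrite tx.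
rewrite !inE !negb_or tx => /andP[yk yK] /andP[eyk eyK] /andP[-> kK].
by rewrite main // eq_sym.
Qed.

Lemma is_contour_merge S y A B :
  is_contour S (y :: A) -> is_contour S (e y :: B) -> ~~ same S y (e y) ->
  is_contour (toggle S y) (y :: B ++ e y :: A).
Proof.
move=> cA cB ns; have /andP[uA pA] := cA; have /andP[uB pB] := cB.
have dis h : h \in y :: A -> h \notin e y :: B.
  rewrite -(is_contour_same _ cA (mem_head _ _)).
  rewrite -(is_contour_same _ cB (mem_head _ _)) => yh.
  by apply: contra ns => eyh; apply: same_trans yh _; rewrite sameC.
have yB := dis _ (mem_head _ _).
have eyA : e y \notin y :: A by apply/negP=> /dis; rewrite mem_head.
have uu : uniq (y :: B ++ e y :: A).
  rewrite (perm_uniq (_ : perm_eq _ ((y :: A) ++ (e y :: B)))).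
    rewrite cat_uniq uA uB andbT; apply/hasPn=> h hB /=.
    by apply/negP => /dis; rewrite hB.
  by rewrite /= perm_cons perm_catC perm_sym perm_catC /= perm_cons perm_catC.
rewrite /is_contour uu /= rcons_cat cat_path /=.
move: yB eyA pA pB uA uB; rewrite /= !inE !negb_or.
move=> /andP[_ yB] /andP[_ eyA] pA pB /andP[yA _] /andP[eyB _].
have := path_toggle (or_introl (erefl y)) yA eyA pA.
have := path_toggle (or_intror (erefl (e y))) yB eyB pB.
by rewrite edgeK rcons_path /= => /andP[-> ->] ->.
Qed.

Lemma is_contour_split S y A B : is_contour S (y :: A ++ e y :: B) ->
  is_contour (toggle S y) (y :: B) /\ is_contour (toggle S y) (e y :: A).
Proof.
case/andP=> /= /andP[]; rewrite mem_cat inE !negb_or.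
case/and3P=> yA _ yB; rewrite cat_uniq /= negb_or.
case/and4P=> uA /andP[eyA _] eyB uB; rewrite rcons_cat cat_path /=.
case/and3P=> pA lA pB; rewrite /is_contour /= yB uB eyA uA /=; split.
  by have := path_toggle (or_intror (erefl (e y))) yB eyB pB; rewrite edgeK.
by apply: path_toggle; rewrite ?rcons_path ?pA //; left.
Qed.

Lemma is_contour_other S y L : is_contour S L -> y \notin L -> e y \notin L ->
  is_contour (toggle S y) L.
Proof.
case/andP=> uL cL yL eyL; rewrite /is_contour uL /=.
apply: (sub_in_cycle (P := predC (pred2 y (e y)))) cL.
  move=> a b /= /norP[ay aey] _ /eqP <-; rewrite contour_next_toggle tpermD // eq_sym //.
apply/allP=> a aL /=; rewrite negb_or; apply/andP; split.
  by apply: contraNneq yL => <-.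
by apply: contraNneq eyL => <-.
Qed.

End Contours.

(** * Turning, and its change when an edge is toggled *)

Section Merge.
Variables (D : finType) (M : cmap D).
Notation e := (edge M).
Implicit Types S T : edge_set M.

Lemma contour_merge S y : ~~ same S y (e y) ->
  exists A B, [/\ contour S y = y :: A, contour S (e y) = e y :: B,
    contour (toggle S y) y = y :: B ++ e y :: A,
    (y \notin A) && (e y \notin A) & (y \notin B) && (e y \notin B)].
Proof.
move=> ns; have [A cA] := contourE S y; have [B cB] := contourE S (e y).
exists A, B; split=> //.
- apply: contour_cons; apply: is_contour_merge => //.
    by rewrite -cA is_contour_contour.
  by rewrite -cB is_contour_contour.
- have := orbit_uniq (contour_next S) y; rewrite -/(contour S y) cA /= => /andP[-> _] /=.
  by apply: contra ns => eyA; rewrite -mem_contour cA inE eyA orbT.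
- have := orbit_uniq (contour_next S) (e y); rewrite -/(contour S _) cB /= => /andP[-> _] /=.
  by rewrite andbT; apply: contra ns => yB; rewrite sameC -mem_contour cB inE yB orbT.
Qed.

Lemma same_merge S y z : ~~ same S y (e y) ->
  same (toggle S y) y z = same S y z || same S (e y) z.
Proof.
case/contour_merge=> A [B [cA cB c' _ _]].
rewrite -!mem_contour cA cB c' !inE mem_cat inE -!orbA.
by case: (z == y); case: (z \in A); case: (z == e y); case: (z \in B).
Qed.

Lemma contour_other S y z : ~~ same S y z -> ~~ same S (e y) z ->
  contour (toggle S y) z = contour S z.
Proof.
move=> yz eyz; have [L cL] := contourE S z; rewrite cL; apply: contour_cons.
rewrite -cL; apply: is_contour_other; rewrite ?is_contour_contour //.
  by rewrite mem_contour sameC.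
by rewrite mem_contour sameC.
Qed.

Lemma same_other S y z u : ~~ same S y z -> ~~ same S (e y) z ->
  same (toggle S y) z u = same S z u.
Proof. by move=> yz eyz; rewrite -!mem_contour contour_other. Qed.

Lemma same_toggle_mono S y a b : ~~ same S y (e y) ->
  same S a b -> same (toggle S y) a b.
Proof.
move=> ns ab; have [ya|ya] := boolP (same S y a || same S (e y) a); last first.
  by rewrite same_other //; move: ya; rewrite negb_or => /andP[].
rewrite -(same_l (x := y)) ?same_merge //.
by case/orP: ya => /same_trans/(_ ab)->; rewrite ?orbT.
Qed.

(** This is used backwards: if an edge a no longer separates two contours
    after y is toggled, its two sides lay on the two contours that y merged. *)
Lemma same_unmerge S y a b : ~~ same S y (e y) -> same (toggle S y) a b ->
  [\/ same S a b, same S y a /\ same S (e y) b | same S (e y) a /\ same S y b].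
Proof.
move=> ns; have [ya|ya] := boolP (same S y a || same S (e y) a); last first.
  by rewrite same_other; [constructor 1| |]; move: ya; rewrite negb_or => /andP[].
rewrite -(same_l (x := y)) ?same_merge // => yb.
case/orP: ya => ya; case/orP: yb => yb.
- by constructor 1; apply: same_trans yb; rewrite sameC.
- by constructor 2.
- by constructor 3.
- by constructor 1; apply: same_trans yb; rewrite sameC.
Qed.

Variables (d : nat) (w : D -> int).
Hypothesis w_edge : forall h, (w h + w (e h) = d%:Z - 2 :> int)%R.

Local Open Scope ring_scope.

Definition dart_cost S h : int := if on S h then -1 else w h.
Definition turning S x : int := \sum_(h <- contour S x) dart_cost S h.
Local Notation cost := dart_cost.
Local Notation tau := turning.

Lemma turning_list S L x : is_contour S L -> x \in L -> tau S x = \sum_(h <- L) cost S h.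
Proof.
move=> cL xL; rewrite /turning (contour_rot cL xL); apply: perm_big.
by rewrite perm_rot.
Qed.

Lemma turning_same S x y : same S x y -> tau S x = tau S y.
Proof.
move=> xy; rewrite (turning_list (is_contour_contour S y)) //.
by rewrite mem_contour sameC.
Qed.

Lemma cost_toggle S y h : h != y -> h != e y -> cost (toggle S y) h = cost S h.
Proof. by move=> /negbTE hy /negbTE hey; rewrite /dart_cost on_toggle hy hey addbF. Qed.

Lemma sum_cost_toggle S y (L : seq D) : y \notin L -> e y \notin L ->
  \sum_(h <- L) cost (toggle S y) h = \sum_(h <- L) cost S h.
Proof.
move=> yL eyL; rewrite !big_seq; apply: eq_bigr => h hL.
apply: cost_toggle; first by apply: contraNneq yL => <-.
by apply: contraNneq eyL => <-.
Qed.

Lemma turning_other S y z : ~~ same S y z -> ~~ same S (e y) z ->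
  tau (toggle S y) z = tau S z.
Proof.
move=> yz eyz; rewrite /turning contour_other // sum_cost_toggle //.
  by rewrite mem_contour sameC.
by rewrite mem_contour sameC.
Qed.

Lemma cost_pair S y : cost (toggle S y) y + cost (toggle S y) (e y) =
  cost S y + cost S (e y) + (if on S y then d%:Z else - d%:Z).
Proof.
have := w_edge y; rewrite /dart_cost !on_toggle !onE !eqxx orbT !addbT.
by case: (on S y) => /=; lia.
Qed.

(** Only the two darts of y change their cost, from w to -1 or back, and their
    weights add up to d - 2. *)
Lemma turning_merge S y : ~~ same S y (e y) ->
  tau (toggle S y) y =
    tau S y + tau S (e y) + (if on S y then d%:Z else - d%:Z).
Proof.
case/contour_merge=> A [B [cA cB c' /andP[yA eyA] /andP[yB eyB]]].
have := cost_pair S y; rewrite /turning cA cB c' !big_cons big_cat big_cons /=.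
by rewrite !sum_cost_toggle //; case: (on S y) => /=; lia.
Qed.

End Merge.

(** * Homotopy of walks *)

Section Homotopy.
Variables (D : eqType) (M : cmap D).
Notation e := (edge M).

Lemma walk_cons x y u : walk M x (y :: u) = same_vertex M x y && walk M (e y) u.
Proof. by rewrite /walk /= /consecutive edgeK edgeK. Qed.

Lemma walk_end_cons x y u : walk_end M x (y :: u) = walk_end M (e y) u.
Proof. by rewrite /walk_end /= edgeK. Qed.

Lemma walk_end_nil x : walk_end M x [::] = x.
Proof. by rewrite /walk_end /= edgeK. Qed.

(** The base dart of homotopic only stands for its vertex. *)
Lemma homotopy_vertex x y u v : same_vertex M x y ->
  homotopic M x u v -> homotopic M y u v.
Proof.
move=> xy; elim=> {u v} [u v [s1 [s [s2 [-> -> wu ns]]]]|u|u v _|u v t _ uv _ vt].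
- by apply: rst_step; exists s1, s, s2; split=> //; rewrite -(walk_vertex _ xy).
- exact: rst_refl.
- exact: rst_sym.
- exact: rst_trans uv vt.
Qed.

Lemma homotopy_ctx_walk x s u v t : homotopic M (walk_end M x s) u v ->
  walk M x (s ++ u ++ t) -> walk M x (s ++ v ++ t).
Proof.
move=> uv; rewrite !walk_cat => /and3P[-> wu wt].
by have [-> e_uv] := homotopic_walk uv wu; rewrite -(walk_vertex _ e_uv).
Qed.

Lemma homotopy_ctx x s u v t : homotopic M (walk_end M x s) u v ->
  walk M x (s ++ u ++ t) -> homotopic M x (s ++ u ++ t) (s ++ v ++ t).
Proof.
elim=> {u v} [u v [s1 [f [s2 [-> -> wu nf]]]] w|u _|u v uv IH w|u v r uv IH1 vr IH2 w].
- apply: rst_step; exists (s ++ s1), f, (s2 ++ t); split=> //.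
    by rewrite -!catA.
  by rewrite -!catA.
- exact: rst_refl.
- apply: rst_sym; apply: IH; apply: homotopy_ctx_walk w; exact: rst_sym.
- by apply: rst_trans (IH1 w) (IH2 _); apply: homotopy_ctx_walk w.
Qed.

Lemma homotopy_ctx_at x z s u v t : same_vertex M (walk_end M x s) z ->
  homotopic M z u v -> walk M x (s ++ u ++ t) ->
  homotopic M x (s ++ u ++ t) (s ++ v ++ t).
Proof.
move=> ez uv; apply: homotopy_ctx; apply: homotopy_vertex uv.
by rewrite same_vertex_sym.
Qed.

Lemma homotopy_backtrack x s y t : walk M x (s ++ y :: e y :: t) ->
  homotopic M x (s ++ y :: e y :: t) (s ++ t).
Proof.
by move=> w; apply: rst_step; exists s, [:: y; e y], t; split=> //; left; exists y.
Qed.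

Definition reverse_walk u := rev (map e u).

Lemma reverse_rcons u y : reverse_walk (rcons u y) = e y :: reverse_walk u.
Proof. by rewrite /reverse_walk map_rcons rev_rcons. Qed.

Lemma walk_reverse x u : walk M x u ->
  walk M (walk_end M x u) (reverse_walk u)
  /\ same_vertex M (walk_end M (walk_end M x u) (reverse_walk u)) x.
Proof.
elim/last_ind: u => [|u y IH]; first by rewrite !walk_end_nil same_vertex_refl.
rewrite walk_rcons reverse_rcons walk_end_rcons walk_cons walk_end_cons edgeK.
case/andP=> /IH[w1 w2] uy; rewrite same_vertex_refl /=.
rewrite -(walk_vertex _ uy) w1; split=> //; apply: same_vertex_trans w2.
by apply: walk_end_vertex; rewrite same_vertex_sym.
Qed.

Lemma homotopy_reverse x u : walk M x u ->
  homotopic M x (u ++ reverse_walk u) [::].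
Proof.
elim/last_ind: u => [|u y IH] wuy; first exact: rst_refl.
have /andP[wu uy] : walk M x u && same_vertex M (walk_end M x u) y.
  by rewrite -walk_rcons.
rewrite reverse_rcons cat_rcons; apply: rst_trans (IH wu).
apply: homotopy_backtrack; rewrite -cat_rcons walk_cat wuy walk_end_rcons.
rewrite walk_cons same_vertex_refl edgeK /= -(walk_vertex _ uy).
by case: (walk_reverse wu).
Qed.

(** Cancelling u against its reverse, then u itself. *)
Lemma homotopy_inverse x u : walk M x u -> same_vertex M x (walk_end M x u) ->
  homotopic M x u [::] -> homotopic M x (reverse_walk u) [::].
Proof.
move=> wu cu hu; have [wr er] := walk_reverse wu.
apply: rst_trans (homotopy_reverse wu); apply: rst_sym.
have := @homotopy_ctx x [::] u [::] (reverse_walk u); rewrite walk_end_nil /=.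
by apply=> //; rewrite walk_cat wu.
Qed.

End Homotopy.

(** * Null-homotopic contours *)

Section Words.
Variables (D : finType) (M : cmap D).
Notation e := (edge M).
Implicit Types S T : edge_set M.

(** The walk in the graph made by a contour: darts that are only turned past
    do not move it. *)
Definition word S (L : seq D) := [seq h <- L | on S h].
Definition null_contour S h : Prop := homotopic M h (word S (contour S h)) [::].

Lemma word_cat S L K : word S (L ++ K) = word S L ++ word S K.
Proof. exact: filter_cat. Qed.

Lemma word_toggle S y L : y \notin L -> e y \notin L ->
  word (toggle S y) L = word S L.
Proof.
move=> yL eyL; apply: eq_in_filter => h hL; rewrite on_toggle.
by case: eqP hL yL => [->->//|_]; case: eqP eyL => [->/negP//|]; rewrite addbF.
Qed.

Lemma contour_next_vertex S h : same_vertex M (if on S h then e h else h) (contour_next S h).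
Proof. exact: same_vertex_next. Qed.

Lemma path_walk S h p : fpath (contour_next S) h p ->
  walk M h (word S (belast h p))
  /\ same_vertex M (walk_end M h (word S (belast h p))) (last h p).
Proof.
elim: p h => [|k p IH] h /=; first by rewrite walk_end_nil same_vertex_refl.
case/andP=> /eqP hk /IH[wp ep]; have := contour_next_vertex S h; rewrite hk.
case: ifP => _ hkv.
  rewrite walk_cons walk_end_cons same_vertex_refl (walk_vertex _ hkv); split=> //.
  by apply: same_vertex_trans ep; apply: walk_end_vertex.
rewrite (walk_vertex _ hkv); split=> //.
by apply: same_vertex_trans ep; apply: walk_end_vertex.
Qed.

Lemma cycle_walk S h L : fcycle (contour_next S) (h :: L) ->
  walk M h (word S (h :: L))
  /\ same_vertex M (walk_end M h (word S (h :: L))) h.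
Proof. by move=> /= /path_walk; rewrite belast_rcons last_rcons. Qed.

Lemma contour_walk S h : walk M h (word S (contour S h))
  /\ same_vertex M (walk_end M h (word S (contour S h))) h.
Proof.
have [L cL] := contourE S h; rewrite cL; apply: cycle_walk.
by rewrite -cL; case/andP: (is_contour_contour S h).
Qed.

(** Changing the starting dart of a contour conjugates its word by the darts
    skipped, and conjugation preserves null-homotopy. *)
Lemma null_contour_next S h : null_contour S h -> null_contour S (contour_next S h).
Proof.
rewrite /null_contour; have [L cL] := contourE S h; rewrite cL.
have [L' cL'] := contourE S (contour_next S h).
have /andP[_ cyc] := is_contour_contour S h.
case: L => [|k K] in cL *.
  by move: cyc; rewrite cL /= andbT => /eqP->; rewrite cL.
have kE : contour_next S h = k by move: cyc; rewrite cL /= => /andP[/eqP].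
have -> : contour S (contour_next S h) = rcons (k :: K) h.
  rewrite rcons_cons kE; apply: contour_cons; rewrite -rcons_cons -rot1_cons -cL.
  by rewrite is_contour_rot is_contour_contour.
have [wh _] := contour_walk S h; have := contour_next_vertex S h; rewrite cL kE in wh *.
rewrite -cats1 word_cat [word S [:: h]]/= [word S (h :: _)]/= in wh *.
move: wh; case: ifP => hS wh hk hom; last first.
  by rewrite cats0; apply: homotopy_vertex hom.
apply: (homotopy_vertex hk); set u := word S (k :: K) in wh hom *.
move: wh; rewrite walk_cons => /andP[_ wu].
have [wh ch] : walk M (e h) u /\ same_vertex M (walk_end M (e h) u) h.
  split=> //; have [_] := contour_walk S h; rewrite cL.
  by rewrite [word _ _]/= hS walk_end_cons.
have w1 : walk M (e h) ([:: e h] ++ (h :: u) ++ [:: h]).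
  rewrite /= !walk_cons !edgeK !same_vertex_refl /= walk_cat wh walk_cons ch.
  by [].
apply: rst_trans (_ : homotopic M (e h) [:: e h; h] [::]).
  apply: rst_trans (rst_sym _ _ _ _ _) (homotopy_ctx_at _ hom w1).
    have := @homotopy_backtrack D M (e h) [::] (e h) (u ++ [:: h]).
    by rewrite edgeK; apply; apply: w1.
  by rewrite walk_end_cons walk_end_nil edgeK same_vertex_refl.
have := @homotopy_backtrack D M (e h) [::] (e h) [::].
by rewrite edgeK; apply; rewrite !walk_cons !edgeK !same_vertex_refl.
Qed.

Lemma null_contour_same S x y : same S x y -> null_contour S x -> null_contour S y.
Proof.
move/iter_findex <-; elim: (findex _ _ _) => //= n IH /IH; exact: null_contour_next.
Qed.

Lemma null_contour_other S y z : ~~ same S y z -> ~~ same S (e y) z ->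
  null_contour (toggle S y) z = null_contour S z.
Proof.
move=> yz eyz; rewrite /null_contour contour_other // word_toggle //.
  by rewrite mem_contour sameC.
by rewrite mem_contour sameC.
Qed.

(** The merged word is the product of the two words, the second conjugated by
    y when y is being added, and shortened by the backtrack along y when it is
    being removed; so a null-homotopic factor can be dropped. *)
Lemma null_contour_merge S y : ~~ same S y (e y) -> null_contour S (e y) ->
  null_contour (toggle S y) y <-> null_contour S y.
Proof.
move=> ns; have [wy cy] := contour_walk S y; have [wey cey] := contour_walk S (e y).
have [w' c'] := contour_walk (toggle S y) y.
rewrite /null_contour; case/contour_merge: ns => A [B].
case=> cA cB c; move: wy cy wey cey w' c'; rewrite cA cB c => wy cy wey cey w' c'.
case/andP=> yA eyA /andP[yB eyB].
move: wy cy wey cey w' c'; rewrite /= word_cat /= !word_toggle //.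
rewrite !on_toggle !onE !eqxx orbT !addbT.
set a := word S A; set b := word S B; case: (boolP (on S y)) => yS /=.
  move=> wy cy wey cey w' c' hb.
  (* Inserting the null-homotopic word of e y after y produces a backtrack. *)
  have w1 : walk M y ([:: y] ++ (e y :: b) ++ a).
    rewrite /= !walk_cons same_vertex_refl edgeK same_vertex_refl /= !walk_cat.
    by move: w'; rewrite walk_cat.
  have h1 : homotopic M y ([:: y] ++ (e y :: b) ++ a) (y :: a).
    apply: (homotopy_ctx_at _ hb w1).
    by rewrite walk_end_cons walk_end_nil same_vertex_refl.
  have h2 : homotopic M y ([:: y] ++ (e y :: b) ++ a) (b ++ a).
    exact: (@homotopy_backtrack D M y [::] y (b ++ a)).
  split=> h; first by apply: rst_trans h; apply: rst_trans h2; apply: rst_sym.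
  by apply: rst_trans h; apply: rst_trans h1; apply: rst_sym.
move=> wy cy wey cey w' c' hb.
have h1 : homotopic M y (y :: b ++ e y :: a) (y :: e y :: a).
  apply: (@homotopy_ctx_at D M y (e y) [:: y] b [::] (e y :: a)) => //.
  by rewrite walk_end_cons walk_end_nil same_vertex_refl.
have h2 : homotopic M y (y :: e y :: a) a.
  apply: (@homotopy_backtrack D M y [::] y a).
  by rewrite !walk_cons !same_vertex_refl edgeK.
split=> h; first by apply: rst_trans h; apply: rst_sym; apply: rst_trans h1 h2.
exact: rst_trans (rst_trans _ _ _ _ _ h1 h2) h.
Qed.

End Words.

(** * Levels, discs and forests *)

Section Levels.
Variables (D : finType) (M : cmap D).
Notation N := (next M).
Notation e := (edge M).
Implicit Types S T : edge_set M.

Lemma not_same_toggle S y : same S y (e y) -> ~~ same (toggle S y) y (e y).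
Proof.
move=> s; apply/negP => s'; have := ncontours_split s; have := ncontours_split s'.
by rewrite toggleK; lia.
Qed.

Lemma same_toggle S y : ~~ same S y (e y) -> same (toggle S y) y (e y).
Proof. by move=> s; rewrite same_merge // same_refl orbT. Qed.

Lemma card_toggle_on S y : on S y -> #|val S| = #|val (toggle S y)|.+2.
Proof.
move=> yS; have := @card_toggle _ _ (toggle S y) y.
by rewrite toggleK toggle_self yS => ->.
Qed.

Lemma edge_set_add_ind (P : edge_set M -> Prop) :
  (forall S, (forall y, ~~ on S y -> P (toggle S y)) -> P S) -> forall S, P S.
Proof.
move=> IH S; have [n] := ubnP (#|D| - #|val S|); elim: n S => // n IHn S lt.
apply: IH => y yS; apply: IHn; have := card_toggle yS.
by have := max_card (val (toggle S y)); lia.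
Qed.

Lemma edge_set_del_ind (P : edge_set M -> Prop) :
  (forall S, (forall y, on S y -> P (toggle S y)) -> P S) -> forall S, P S.
Proof.
move=> IH S; have [n] := ubnP #|val S|; elim: n S => // n IHn S lt.
by apply: IH => y yS; apply: IHn; have := card_toggle_on yS; lia.
Qed.

Lemma full_or_off S : S = all_edge M \/ exists y, ~~ on S y.
Proof.
case: (pickP (fun y => ~~ on S y)) => [y|f]; first by right; exists y.
by left; apply: edge_set_ext => h; rewrite onT; have /negbFE := f h.
Qed.

Lemma empty_or_on S : S = no_edge M \/ exists y, on S y.
Proof.
case: (pickP (fun y => on S y)) => [y|f]; first by right; exists y.
by left; apply: edge_set_ext => h; rewrite on0 f.
Qed.

Definition nverts := fcard N D.
Definition nfaces := fcard (face M) D.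
Definition nedges := fcard e D.

Hypothesis euler : nverts + nfaces = nedges.

Lemma card_darts : #|D| = 2 * nedges.
Proof.
rewrite mulnC /nedges -(@fcard_order_set _ _ (@edge_inj _ M) 2 D) //; last first.
  apply/subsetP=> x _; rewrite inE; apply/eqP.
  apply: (@order_cycle _ e [:: x; e x]); rewrite /= ?inE ?edgeK ?eqxx //.
  by rewrite eq_sym edge_neq.
Qed.

Lemma ncontours0 : ncontours (no_edge M) = nverts.
Proof. by apply: eq_fcard => x; rewrite contour_next_off // on0. Qed.

Lemma ncontoursT : ncontours (all_edge M) = nfaces.
Proof. by apply: eq_fcard => x; rewrite contour_next_on // onT. Qed.

(** The number of merges among the missing edges, whatever the order in which
    they are added. For a ribbon graph with k components of total genus g it
    equals k - g; the division is exact by levelE, which is where the Euler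
    characteristic of the torus enters. *)
Definition level S := (2 * (ncontours S + nverts) - #|val S|) %/ 4.

Lemma levelE S : 2 * (ncontours S + nverts) = #|val S| + 4 * level S.
Proof.
suff [m mE] : exists m, 2 * (ncontours S + nverts) = #|val S| + 4 * m.
  by rewrite /level mE addKn mulKn.
elim/edge_set_add_ind: S => S IH; case: (full_or_off S) => [->|[y yS]].
  by exists 0; rewrite ncontoursT [val _]/= cardsT card_darts; have := euler; lia.
have [m mE] := IH y yS; have := card_toggle yS.
have [s|s] := boolP (same S y (e y)).
  by have := ncontours_split s; exists m; lia.
by have := ncontours_merge s; exists m.+1; lia.
Qed.

Lemma level0 : level (no_edge M) = nverts.
Proof. by have := levelE (no_edge M); rewrite ncontours0 [val _]/= cards0; lia. Qed.

Lemma level_merge_add S y : ~~ on S y -> ~~ same S y (e y) ->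
  level S = (level (toggle S y)).+1.
Proof.
move=> yS s; have := levelE S; have := levelE (toggle S y).
by have := card_toggle yS; have := ncontours_merge s; lia.
Qed.

Lemma level_split_add S y : ~~ on S y -> same S y (e y) ->
  level (toggle S y) = level S.
Proof.
move=> yS s; have := levelE S; have := levelE (toggle S y).
by have := card_toggle yS; have := ncontours_split s; lia.
Qed.

Lemma level_merge_del S y : on S y -> ~~ same S y (e y) ->
  level (toggle S y) = level S.
Proof.
move=> yS s; have := levelE S; have := levelE (toggle S y).
by have := card_toggle_on yS; have := ncontours_merge s; lia.
Qed.

Lemma level_split_del S y : on S y -> same S y (e y) ->
  level (toggle S y) = (level S).+1.
Proof.
move=> yS s; have := levelE S; have := levelE (toggle S y).
by have := card_toggle_on yS; have := ncontours_split s; lia.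
Qed.

(** Removing an edge whose sides lie on one contour raises both sides of the
    inequality by one; if they lie on two contours only the right side drops. *)
Lemma level_le S : level S <= ncontours S.
Proof.
elim/edge_set_del_ind: S => S IH; case: (empty_or_on S) => [->|[y yS]].
  by rewrite level0 ncontours0.
have := IH y yS; have [s|s] := boolP (same S y (e y)).
  by have := ncontours_split s; have := level_split_del yS s; lia.
by have := ncontours_merge s; have := level_merge_del yS s; lia.
Qed.

(** With k components of total genus g there are k - g contours only if g is 0
    and each component has one contour, so this says that S has no cycle. *)
Definition forest S := ncontours S == level S.

Lemma forest_same S y : forest S -> on S y -> same S y (e y).
Proof.
move=> /eqP fS yS; apply/negPn/negP=> s.
have := level_le (toggle S y).
by have := ncontours_merge s; have := level_merge_del yS s; lia.
Qed.

Lemma forest_del S y : forest S -> on S y -> forest (toggle S y).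
Proof.
move=> fS yS; have s := forest_same fS yS; move/eqP: fS => fS.
by apply/eqP; have := ncontours_split s; have := level_split_del yS s; lia.
Qed.

Lemma forest_add S y : forest S -> ~~ same S y (e y) ->
  forest (toggle S y) /\ ~~ on S y.
Proof.
move=> fS s; have yS : ~~ on S y by apply: contra s; apply: forest_same.
split=> //; move/eqP: fS => fS; apply/eqP.
by have := ncontours_merge s; have := level_merge_add yS s; lia.
Qed.

Lemma level0_same S y : level S = 0 -> ~~ on S y -> same S y (e y).
Proof.
by move=> l0 yS; apply/negPn/negP=> s; have := level_merge_add yS s; lia.
Qed.

Lemma orbit_contour S z f : (forall y, same S z y -> contour_next S y = f y) ->
  contour S z = orbit f z.
Proof.
move=> tf; have /andP[uL cL] := is_contour_contour S z.
have cf : fcycle f (contour S z).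
  apply: (sub_in_cycle (P := same S z)) cL; last first.
    by apply/allP => h; rewrite mem_contour.
  by move=> a b za _ /eqP <-; rewrite /= tf.
rewrite (orbitE cf) ?mem_contour ?same_refl //.
by have [L ->] := contourE S z; rewrite /= eqxx rot0.
Qed.

Variables (d : nat) (w : D -> int).
Local Open Scope ring_scope.
Hypothesis ang : angulation M d.
Definition weighting := (forall h, w h + w (e h) = d%:Z - 2 :> int) /\
  (forall h, \sum_(y <- orbit N h) w y = d%:Z).
Hypothesis ww : weighting.
Local Notation tau := (turning w).

Lemma turning_merge_add S y : ~~ on S y -> ~~ same S y (e y) ->
  tau (toggle S y) y = tau S y + tau S (e y) - d%:Z.
Proof. by move=> /negbTE yS s; rewrite (turning_merge ww.1 s) yS. Qed.

Lemma turning_merge_del S y : on S y -> ~~ same S y (e y) ->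
  tau (toggle S y) y = tau S y + tau S (e y) + d%:Z.
Proof. by move=> yS s; rewrite (turning_merge ww.1 s) yS. Qed.

Lemma turning_split_add S y : ~~ on S y -> same S y (e y) ->
  tau S y = tau (toggle S y) y + tau (toggle S y) (e y) + d%:Z.
Proof.
move=> yS s; rewrite -{1}(toggleK S y) turning_merge_del ?not_same_toggle //.
by rewrite toggle_self.
Qed.

Lemma turning_split_del S y : on S y -> same S y (e y) ->
  tau S y = tau (toggle S y) y + tau (toggle S y) (e y) - d%:Z.
Proof.
move=> yS s; rewrite -{1}(toggleK S y) turning_merge_add ?not_same_toggle //.
by rewrite toggle_self yS.
Qed.

(** The two values of Gauss-Bonnet for a contour that bounds a disc: disc if
    it lies in the complement of the ribbon graph, treelike if it is the
    ribbon neighbourhood of a plane tree. *)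
Definition disc S z := tau S z = - d%:Z /\ null_contour S z.
Definition treelike S z := tau S z = d%:Z /\ null_contour S z.

Lemma null_contour_split S y : same S y (e y) ->
  null_contour (toggle S y) y -> null_contour (toggle S y) (e y) -> null_contour S y.
Proof.
move=> s cy cey; have := null_contour_merge (not_same_toggle s) cey.
by rewrite toggleK => -[_]; apply.
Qed.

Lemma treelike_vertex S z : (forall y, same S z y -> ~~ on S y) -> treelike S z.
Proof.
move=> off; have cE : contour S z = orbit N z.
  by apply: orbit_contour => y /off; apply: contour_next_off.
rewrite /treelike /null_contour /turning; split.
  rewrite -(ww.2 z) cE !big_seq; apply: eq_bigr => y yz.
  by rewrite /dart_cost (negbTE (off y _)) // -mem_contour cE.
suff -> : word S (contour S z) = [::] by apply: rst_refl.
apply/eqP; rewrite -[_ == _]negbK -has_filter; apply/hasPn => y.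
by rewrite mem_contour; apply: off.
Qed.

Lemma disc_face S z : (forall y, same S z y -> on S y) -> disc S z.
Proof.
move=> ful; have cE : contour S z = orbit (face M) z.
  by apply: orbit_contour => y /ful; apply: contour_next_on.
have wE : word S (contour S z) = orbit (face M) z.
  rewrite -cE; apply/all_filterP/allP => y; rewrite mem_contour; exact: ful.
rewrite /disc /null_contour /turning; split.
  rewrite (eq_big_seq (fun=> -1)); last first.
    by move=> y; rewrite mem_contour /dart_cost => /ful ->.
  rewrite cE big_const_seq count_predT iter_addr_0 size_orbit ang.
  by rewrite mulNrn natz.
rewrite wE; apply: rst_step; exists [::], (orbit (face M) z), [::].
split; rewrite ?cats0 //; first by have [] := contour_walk S z; rewrite wE.
right; exists z, (fingraph.order (face M) z); split=> //.
exact: (iter_order (@face_inj _ M)).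
Qed.

Lemma treelike_same S x y : same S x y -> treelike S x -> treelike S y.
Proof. by move=> xy [k c]; split; [rewrite -(turning_same w xy)|apply: null_contour_same c]. Qed.

Lemma disc_same S x y : same S x y -> disc S x -> disc S y.
Proof. by move=> xy [k c]; split; [rewrite -(turning_same w xy)|apply: null_contour_same c]. Qed.

Lemma disc_other S y z : ~~ same S y z -> ~~ same S (e y) z ->
  disc (toggle S y) z <-> disc S z.
Proof. by move=> yz eyz; rewrite /disc turning_other // null_contour_other. Qed.

Lemma treelike_other S y z : ~~ same S y z -> ~~ same S (e y) z ->
  treelike (toggle S y) z <-> treelike S z.
Proof. by move=> yz eyz; rewrite /treelike turning_other // null_contour_other. Qed.

Lemma treelike_forest S z : forest S -> treelike S z.
Proof.
elim/edge_set_del_ind: S z => S IH z fS.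
case: (pickP (fun y => same S z y && on S y)) => [y /andP[zy yS]|off]; last first.
  by apply: treelike_vertex => y zy; have := off y; rewrite zy => /negbT.
have s := forest_same fS yS; have fS' := forest_del fS yS.
have [ky cy] := IH y yS y fS'; have [key cey] := IH y yS (e y) fS'.
apply: (@treelike_same _ y); first by rewrite sameC.
by split; [rewrite turning_split_del // ky key; lia|apply: null_contour_split].
Qed.

Lemma disc_split S y : ~~ on S y -> same S y (e y) ->
  disc (toggle S y) y -> disc (toggle S y) (e y) -> disc S y.
Proof.
move=> yS s [ky cy] [key cey].
by split; [rewrite turning_split_add // ky key; lia|apply: null_contour_split].
Qed.

(** At level 0 every missing edge splits a contour, so cutting along the
    missing edges ends with faces. *)
Lemma disc_level0 S z : level S = 0%N -> disc S z.
Proof.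
elim/edge_set_add_ind: S z => S IH z l0.
case: (pickP (fun y => same S z y && ~~ on S y)) => [y /andP[zy yS]|f]; last first.
  by apply: disc_face => y zy; have := f y; rewrite zy => /negbFE.
have s := level0_same l0 yS; have l0' := level_split_add yS s; rewrite l0 in l0'.
apply: (@disc_same _ y); first by rewrite sameC.
by apply: disc_split; rewrite // ; apply: IH.
Qed.

(** At level 1 one merge is left. Hence once g is added a can merge nothing,
    and its two sides must lie on the two contours that g joined. *)
Lemma joining_pair S g a : level S = 1%N -> ~~ on S g -> ~~ same S g (e g) ->
  ~~ on S a -> ~~ same S a (e a) ->
  (same S g a /\ same S (e g) (e a)) \/ (same S g (e a) /\ same S (e g) a).
Proof.
move=> l1 gS gs aS sa; have l0 := level_merge_add gS gs; rewrite l1 in l0.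
have [ga|ga] := boolP ((a == g) || (a == e g)).
  case/orP: ga => /eqP ->; first by left; rewrite !same_refl.
  by right; rewrite edgeK !same_refl.
have aS' : ~~ on (toggle S g) a by rewrite on_toggle (negbTE aS) (negbTE ga).
have /(same_unmerge gs)[|[]|[]] := level0_same (esym (succn_inj l0)) aS'.
- by move/negP: sa.
- by left.
- by right.
Qed.

(** Adding g leaves the contour of z alone and brings the level down to 0. *)
Lemma joining_third S g z : level S = 1%N -> ~~ on S g -> ~~ same S g (e g) ->
  ~~ same S g z -> ~~ same S (e g) z -> disc S z.
Proof.
move=> l1 gS gs gz egz; apply/(disc_other gz egz)/disc_level0.
by have := level_merge_add gS gs; rewrite l1 => -[].
Qed.

(** By disc_level0 the merged contour has turning -d, and merging loses d. The
    two contours are the ends of an annulus. *)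
Lemma joining_sum S g : level S = 1%N -> ~~ on S g -> ~~ same S g (e g) ->
  tau S g + tau S (e g) = 0.
Proof.
move=> l1 gS gs; have l0 := level_merge_add gS gs.
have [] := @disc_level0 (toggle S g) g; first by lia.
by rewrite turning_merge_add //; lia.
Qed.

(** Cut along the missing edges on the contour of a. An edge that joins two
    contours leaves that of b aside, and joining_third makes b a disc;
    otherwise the contour of a is split and both halves are handled by
    induction. *)
Lemma separated_disc S a b : level S = 1%N -> ~~ same S a b ->
  (forall y, ~~ on S y -> same S a y -> ~~ same S b (e y)) ->
  disc S a \/ disc S b.
Proof.
elim/edge_set_add_ind: S a => S IH a l1 ab sep.
case: (pickP (fun y => same S a y && ~~ on S y)) => [y /andP[ay yS]|f]; last first.
  by left; apply: disc_face => y ay; have := f y; rewrite ay => /negbFE.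
have yb : ~~ same S y b by rewrite -(same_l ay).
have eyb : ~~ same S (e y) b by rewrite sameC sep.
have [s|s] := boolP (same S y (e y)); last first.
  by right; apply: (joining_third l1 yS s).
have ns := not_same_toggle s.
have l1' := level_split_add yS s; rewrite l1 in l1'.
have back u v : same (toggle S y) u v -> same S u v.
  by move/(same_toggle_mono ns); rewrite toggleK.
have IH' z : z = y \/ z = e y -> disc (toggle S y) z \/ disc S b.
  move=> zE; have az : same S a z.
    by case: zE => ->; rewrite // -(same_r _ s).
  case: (IH y yS z l1') => [||dz|/disc_other]; try by [left].
  - by apply/negP=> /back; rewrite -(same_l az); apply/negP.
  - move=> u; rewrite on_toggle negb_add => uS /back zu.
    apply/negP => /back; apply/negP.
    have au : same S a u by rewrite (same_l az).
    case: (boolP (on S u)) uS => uS; last by move=> _; apply: sep.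
    move/eqP/esym/orP=> [] /eqP uE; first by rewrite uE sameC.
    by rewrite uE edgeK sameC.
  - by right; auto.
case: (IH' y) => [|dy|]; [by left| |by right].
case: (IH' (e y)) => [|dey|]; [by right| |by right].
left; apply: (@disc_same _ y); first by rewrite sameC.
exact: disc_split.
Qed.

End Levels.

(** * Three pairwise crossing edges *)

Section Hexagon.
Variables (D : finType) (M : cmap D).
Notation N := (next M).
Notation e := (edge M).
Implicit Types S T : edge_set M.
Variables (d : nat) (w : D -> int).
Local Open Scope ring_scope.
Hypothesis w_edge : forall h, (w h + w (e h) = d%:Z - 2 :> int)%R.
Local Notation tau := (turning w).
Local Notation cost := (dart_cost w).

Lemma is_contour_shift S A B : is_contour S (A ++ B) = is_contour S (B ++ A).
Proof. by rewrite -(is_contour_rot _ (size A)) rot_size_cat. Qed.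

Lemma is_contour_split_at S y A B C :
  is_contour S (A ++ y :: B ++ e y :: C) ->
  is_contour (toggle S y) (y :: C ++ A) /\ is_contour (toggle S y) (e y :: B).
Proof. by rewrite is_contour_shift /= -catA /= => /is_contour_split. Qed.

(** What toggling x adds to the sum of all turnings. *)
Definition toggle_gain S x : int := if on S x then d%:Z else - d%:Z.

(** The six darts cut the contour into a hexagon whose opposite sides are
    glued. The contours obtained by toggling x, y or z alone, and all three,
    are unions of the same six arcs, so that the relation between their
    turnings can be read off the arcs. On the torus the three cycles have
    classes u, u + v and v, and this is additivity of the turning. *)
Lemma hexagon_cyclic S x y z a1 a2 a3 b1 b2 b3 :
  is_contour S (x :: a1 ++ y :: a2 ++ z :: a3 ++ e x :: b1 ++ e y :: b2 ++ e z :: b3) ->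
  ~~ same (toggle S x) y (e y) ->
  (forall h, tau (toggle (toggle (toggle S x) y) z) h = toggle_gain S y) ->
  tau (toggle S x) (e x) - tau (toggle S y) (e y) + tau (toggle S z) (e z) = 0.
Proof.
move=> cS nxy triple; have /andP[uS _] := cS.
set L := x :: _ in cS uS.
(* Uniqueness of the list as one counting inequality, from which arithmetic
   derives that the six darts are distinct and absent from the arcs. *)
have cnt u : ((x == u) + (count_mem u a1 + ((y == u) + (count_mem u a2 +
    ((z == u) + (count_mem u a3 + ((e x == u) + (count_mem u b1 + ((e y == u) +
    (count_mem u b2 + ((e z == u) + count_mem u b3)))))))))) <= 1)%N.
  have: (count_mem u L <= 1)%N by rewrite count_uniq_mem //; case: (_ \in _).
  by rewrite /L /=; do !rewrite count_cat /=.
have nin u l : u \in [:: x; e x; y; e y; z; e z] ->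
    l \in [:: a1; a2; a3; b1; b2; b3] -> u \notin l.
  move=> uE lE; rewrite -has_pred1 has_count -leqNgt leqn0.
  have c1 : ((x == u) + ((y == u) + ((z == u) + ((e x == u) + ((e y == u) +
    (e z == u))))) > 0)%N.
    by move: uE; rewrite !inE => /or4P[|||/or3P[]] /eqP->;
      rewrite eqxx !addn_gt0 ?orbT.
  have := cnt u; move: c1 lE; rewrite !inE.
  do 6!move: (nat_of_bool _) => ?.
  by move=> ? /or4P [|||/or3P[]] /eqP->; lia.
have [yx yex] : y != x /\ y != e x.
  split; apply/negP => h; [have := cnt x | have := cnt (e x)]; rewrite h eqxx;
    by do 4!move: (nat_of_bool (_ == _)) => ?; lia.
have [zx zex] : z != x /\ z != e x.
  split; apply/negP => h; [have := cnt x | have := cnt (e x)]; rewrite h eqxx;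
    by do 4!move: (nat_of_bool (_ == _)) => ?; lia.
have [zy zey] : z != y /\ z != e y.
  split; apply/negP => h; [have := cnt y | have := cnt (e y)]; rewrite h eqxx;
    by do 4!move: (nat_of_bool (_ == _)) => ?; lia.
have sumE S' l : l \in [:: a1; a2; a3; b1; b2; b3] ->
    S' \in [:: S; toggle S x; toggle S y; toggle S z; toggle (toggle (toggle S x) y) z] ->
    \sum_(h <- l) cost S' h = \sum_(h <- l) cost S h.
  move=> lE; rewrite !inE => /or4P[/eqP->//|/eqP->|/eqP->|/orP[]/eqP->];
    by rewrite !sum_cost_toggle // (nin _ _ _ lE) // !inE eqxx ?orbT.
have costE S' u v : u != v -> u != e v -> cost (toggle S' v) u = cost S' u.
  exact: cost_toggle.
have [c1 cx] : is_contour (toggle S x) (x :: (b1 ++ e y :: b2 ++ e z :: b3) ++ [::]) /\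
    is_contour (toggle S x) (e x :: a1 ++ y :: a2 ++ z :: a3).
  by apply: is_contour_split_at; rewrite /= -!catA /= -!catA.
have [_ cy] : is_contour (toggle S y) (y :: (b2 ++ e z :: b3) ++ (x :: a1)) /\
    is_contour (toggle S y) (e y :: a2 ++ z :: a3 ++ e x :: b1).
  by apply: is_contour_split_at; rewrite /= -!catA /= -!catA.
have [_ cz] : is_contour (toggle S z) (z :: b3 ++ (x :: a1 ++ y :: a2)) /\
    is_contour (toggle S z) (e z :: a3 ++ e x :: b1 ++ e y :: b2).
  by apply: is_contour_split_at; rewrite /= -!catA /= -!catA.
have ct : is_contour (toggle (toggle (toggle S x) y) z)
    (e z :: a3 ++ e x :: a1 ++ y :: b2).
  have c1' : is_contour (toggle S x) (e y :: b2 ++ e z :: b3 ++ x :: b1).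
    have := is_contour_shift (toggle S x) (x :: b1) (e y :: b2 ++ e z :: b3).
    by rewrite /= -!catA /= => <-; rewrite cats0 in c1.
  have cx' : is_contour (toggle S x) (y :: a2 ++ z :: a3 ++ e x :: a1).
    have := is_contour_shift (toggle S x) (e x :: a1) (y :: a2 ++ z :: a3).
    by rewrite /= -!catA /= => <-.
  have := is_contour_merge cx' c1' nxy; rewrite -{1}[z](edgeK M) => c2.
  have := @is_contour_split_at (toggle (toggle S x) y) (e z) (y :: b2)
    (b3 ++ x :: b1 ++ e y :: a2) (a3 ++ e x :: a1).
  by rewrite edgeK toggle_edge /= -!catA /= -!catA /= => -[|//]; move: c2;
    rewrite edgeK -!catA /= -!catA /=.
move: (triple (e z)); rewrite (turning_list _ cx (mem_head _ _)) (turning_list _ cy (mem_head _ _)).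
rewrite (turning_list _ cz (mem_head _ _)) (turning_list _ ct (mem_head _ _)).
do !rewrite ?big_cons ?big_cat /=.
rewrite !sumE ?inE ?eqxx ?orbT //.
have sym u v : u != v -> u != e v ->
    [/\ (u == v) = false, (u == e v) = false, (v == u) = false & (v == e u) = false].
  move=> uv uev; split; apply/negbTE; rewrite // eq_sym //.
  by rewrite edge_eqC.
have [? ? ? ?] := sym _ _ yx yex; have [? ? ? ?] := sym _ _ zx zex.
have [? ? ? ?] := sym _ _ zy zey.
move: (\sum_(h <- a1) _) (\sum_(h <- a2) _) (\sum_(h <- a3) _) => s1 s2 s3.
move: (\sum_(h <- b1) _) (\sum_(h <- b2) _) => t1 t2.
rewrite /dart_cost /toggle_gain !on_toggle !onE !edge_eqC !edgeK.
do ?match goal with H : (_ == _) = false |- _ => rewrite H; clear H end.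
rewrite !eqxx !orbT !addbF !addbT; have := w_edge y.
move: (w y) (w (e y)) (w (e x)) (w z) (w (e z)) => wy wey wex wz wez.
move: (on S x) (on S y) (on S z) => ox oy oz; clear.
by case: ox; case: oy; case: oz => /=; lia.
Qed.

Lemma one_contour S x y : ncontours S = 1%N -> same S x y.
Proof.
move=> c1; apply/negPn/negP => nxy.
have : (1 < ncontours S)%N by apply/ncontours_gt1P; exists x, y.
by rewrite c1.
Qed.

Lemma split_contour S x : same S x (e x) -> exists A B,
  [/\ contour S x = x :: A ++ e x :: B, contour (toggle S x) x = x :: B &
      contour (toggle S x) (e x) = e x :: A].
Proof.
move=> s; have [L cL] := contourE S x; have cS := is_contour_contour S x.
have exL : e x \in L.
  by move: s; rewrite -mem_contour cL inE (negbTE (edge_neq _ _)).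
case/splitPr: L / exL cL => A B cL; exists A, B.
have cS' : is_contour S (x :: A ++ e x :: B) by rewrite -cL.
have [c1 c2] := is_contour_split cS'.
by split=> //; apply: contour_cons.
Qed.

(** Three chords of a circle that cross pairwise occur, up to exchanging the
    names y and z or the two ends of a chord, in the order required by
    hexagon_cyclic. *)
Lemma hexagon S x y z : ncontours S = 1%N ->
  y != x -> y != e x -> z != x -> z != e x -> z != y -> z != e y ->
  ~~ same (toggle S x) y (e y) -> ~~ same (toggle S x) z (e z) ->
  ~~ same (toggle S y) z (e z) ->
  on S y = on S z ->
  (forall h, tau (toggle (toggle (toggle S x) y) z) h = toggle_gain S y) ->
  (forall h, tau (toggle S x) h = 0) -> (forall h, tau (toggle S y) h = 0) ->
  exists h, tau (toggle S z) h = 0.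
Proof.
move=> c1 yx yex zx zex zy zey nxy nxz nyz oyz triple kx ky.
have [A [B [cS cB cA]]] := split_contour (one_contour x (e x) c1).
have cS' : is_contour S (x :: A ++ e x :: B) by rewrite -cS is_contour_contour.
have place u : u != x -> u != e x -> ~~ same (toggle S x) u (e u) ->
    (u \in A /\ e u \in B) \/ (e u \in A /\ u \in B).
  move=> ux uex nu; have inAB v : v != x -> v != e x -> (v \in A) || (v \in B).
    move=> /negbTE vx /negbTE vex; have := one_contour x v c1.
    by rewrite -mem_contour cS inE mem_cat inE vx vex.
  have sA v v' : v \in A -> v' \in A -> same (toggle S x) v v'.
    move=> vA v'A; apply: (@same_trans _ _ _ (e x)); last first.
      by rewrite -mem_contour cA inE v'A orbT.
    by rewrite sameC -mem_contour cA inE vA orbT.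
  have sB v v' : v \in B -> v' \in B -> same (toggle S x) v v'.
    move=> vB v'B; apply: (@same_trans _ _ _ x); last first.
      by rewrite -mem_contour cB inE v'B orbT.
    by rewrite sameC -mem_contour cB inE vB orbT.
  have eux : e u != x by rewrite edge_eqC.
  have euex : e u != e x by rewrite edge_eqC edgeK.
  case/orP: (inAB _ ux uex) (inAB _ eux euex) => uAB /orP[] euAB; auto.
  - by rewrite sA in nu.
  - by rewrite sB in nu.
have wl y' z' : y' != x -> y' != e x -> z' != x -> z' != e x -> z' != y' ->
    z' != e y' -> y' \in A -> e y' \in B -> z' \in A -> e z' \in B ->
    ~~ same (toggle S x) y' (e y') -> ~~ same (toggle S x) z' (e z') ->
    ~~ same (toggle S y') z' (e z') ->
    on S y' = on S z' ->
    (forall h, tau (toggle (toggle (toggle S x) y') z') h = toggle_gain S y') ->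
    (forall h, tau (toggle S y') h = 0) -> exists h, tau (toggle S z') h = 0.
  move=> yx' yex' zx' zex' zy' zey' yA eyB zA ezB nxy' nxz' nyz' oyz' tr' ky'.
  have pair a b : a \in contour (toggle S y') b -> same (toggle S y') b a.
    by rewrite mem_contour.
  case/splitPr: A / yA cS' zA {cS cA place} => A1 A2; rewrite mem_cat inE.
  case/splitPr: B / eyB ezB {cB} => B1 B2; rewrite mem_cat inE.
  rewrite (negbTE zy') edge_eqC edgeK (negbTE zy') /= => ezB cS' zA.
  (* Of the four relative positions of y' and z', two contradict the
     assumption that they cross. *)
  case/orP: zA => zA; case/orP: ezB => ezB.
  - case/splitPr: A1 / zA cS' => a1 a2; case/splitPr: B1 / ezB => b1 b2 cS'.
    exists (e z'); have := @hexagon_cyclic S x z' y' a1 a2 A2 b1 b2 B2.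
    rewrite kx ky' sub0r addr0 => h; apply/eqP; rewrite -oppr_eq0; apply/eqP.
    apply: h => //; first by move: cS'; do ?rewrite -catA /=.
    by move=> u; rewrite toggleC tr' /toggle_gain oyz'.
  - case/splitPr: A1 / zA cS' => a1 a2; case/splitPr: B2 / ezB => b1 b2 cS'.
    case/negP: nyz'.
    have [c _] := @is_contour_split_at S y' (x :: a1 ++ z' :: a2) (A2 ++ e x :: B1)
      (b1 ++ e z' :: b2) ltac:(by move: cS'; do ?rewrite -catA /=).
    rewrite (is_contour_same _ c); by rewrite !(inE, mem_cat) eqxx !orbT.
  - case/splitPr: A2 / zA cS' => a2 a3; case/splitPr: B1 / ezB => b1 b2 cS'.
    case/negP: nyz'.
    have [_ c] := @is_contour_split_at S y' (x :: A1)
      (a2 ++ z' :: a3 ++ e x :: b1 ++ e z' :: b2)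
      B2 ltac:(by move: cS'; do ?rewrite -catA /=).
    rewrite (is_contour_same _ c); by rewrite !(inE, mem_cat) eqxx !orbT.
  - case/splitPr: A2 / zA cS' => a2 a3; case/splitPr: B2 / ezB => b2 b3 cS'.
    exists (e z'); have := @hexagon_cyclic S x y' z' A1 a2 a3 B1 b2 b3.
    rewrite kx ky' subr0 add0r => h.
    by apply: h => //; move: cS'; do ?rewrite -catA /=.
have eE S' u : toggle S' (e u) = toggle S' u by apply: toggle_edge.
have flip u v : e u != v = (u != e v) by rewrite edge_eqC.
case: (place y yx yex nxy) (place z zx zex nxz) => [][yA yB] [][zA zB].
- exact: (wl y z).
- rewrite -(eE S z); apply: (wl y (e z)); rewrite ?eE ?flip ?edgeK ?onE //.
  by rewrite sameC.
  by rewrite sameC.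
- apply: (wl (e y) z); rewrite ?eE ?flip ?edgeK ?onE //.
  by rewrite sameC.
  by move=> h; rewrite triple /toggle_gain onE.
- rewrite -(eE S z); apply: (wl (e y) (e z)); rewrite ?eE ?flip ?edgeK ?onE //.
  by rewrite sameC.
  by rewrite sameC.
  by rewrite sameC.
  by move=> h; rewrite triple /toggle_gain onE.
Qed.
End Hexagon.

(** * Spanning trees *)

Section Trees.
Variables (D : finType) (M : cmap D).
Notation N := (next M).
Notation e := (edge M).
Implicit Types S T : edge_set M.
Hypothesis euler : nverts M + nfaces M = nedges M.
Hypothesis connected :
  forall x y : D, connect [rel a b | (b == e a) || (b == N a)] x y.
Hypothesis D_gt0 : 0 < #|D|.

(** One contour forces the ribbon graph to be connected, and level 1 forces
    genus 0. So tree means spanning tree. *)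
Definition tree T := (ncontours T == 1) && (level T == 1).

Lemma tree_forest T : tree T -> forest T.
Proof. by case/andP=> /eqP c /eqP l; rewrite /forest c l. Qed.

Lemma tree_same T x y : tree T -> same T x y.
Proof. by case/andP=> /eqP c _; apply: one_contour. Qed.

Lemma forest_tree S : forest S -> ncontours S = 1 -> tree S.
Proof. by move=> /eqP f c; rewrite /tree -f c. Qed.

Lemma ncontours_gt0 S : 0 < ncontours S.
Proof.
have /card_gt0P[x _] := D_gt0.
by apply/(fcard_gt0P (@contour_next_inj _ M S)) => //; exists x.
Qed.

(** Whatever S is, a step of contour_next S and the exchange of the two darts
    of an edge generate the rotation around vertices. *)
Lemma closed_everything S z (A : pred D) : A z ->
  (forall y, A y -> A (contour_next S y)) -> (forall y, A y -> A (e y)) -> forall y, A y.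
Proof.
move=> Az At Ae y; have /connectP[p] := connected z y.
elim: p z Az => [|a p IH] z Az /=; first by move=> _ ->.
case/andP=> za; apply: IH; case/orP: za => /eqP ->; first exact: Ae.
have [zS|zS] := boolP (on S z); last by rewrite -(contour_next_off zS) At.
by rewrite -[z](edgeK M) -/(face M (e z)) -(@contour_next_on _ _ S) ?onE // At // Ae.
Qed.

Lemma exists_joining S : 1 < ncontours S -> exists y, ~~ same S y (e y).
Proof.
case/ncontours_gt1P=> a [b ab]; apply/existsP; apply: contraNT ab.
rewrite negb_exists => /forallP s.
apply: (@closed_everything S a (same S a)); first exact: same_refl.
  by move=> y /same_trans-> //; apply: same_next.
by move=> y ay; apply: same_trans ay _; have := s y; rewrite negbK.
Qed.

Lemma forest_in_tree S : forest S -> exists T, tree T.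
Proof.
have [n] := ubnP (ncontours S); elim: n S => // n IH S lt fS.
have := ncontours_gt0 S; rewrite leq_eqVlt => /orP[/eqP c|/exists_joining[y s]].
  by exists S; apply: forest_tree.
have [fS' _] := forest_add euler fS s; apply: IH fS'.
by have := ncontours_merge s; lia.
Qed.

Lemma exists_tree : exists T, tree T.
Proof.
apply: (forest_in_tree (S := no_edge M)); apply/eqP.
by rewrite ncontours0 level0.
Qed.

Lemma tree_add T a z : tree T -> same (toggle T a) a z || same (toggle T a) (e a) z.
Proof.
move=> tT; have s := tree_same a (e a) tT.
by rewrite -same_merge ?not_same_toggle // toggleK tree_same.
Qed.

Lemma tree_add_level T a : tree T -> ~~ on T a -> level (toggle T a) = 1.
Proof.
move=> tT aT; rewrite level_split_add //; last exact: tree_same.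
by case/andP: tT => _ /eqP.
Qed.

Variables (d : nat) (w : D -> int).
Local Open Scope ring_scope.
Hypothesis ang : angulation M d.
Hypothesis ww : weighting M d w.
Local Notation tau := (turning w).

Lemma tree_add_sum T a : tree T -> ~~ on T a ->
  tau (toggle T a) a + tau (toggle T a) (e a) = 0.
Proof.
move=> tT aT; have [k _] := treelike_forest euler ww a (tree_forest tT).
have := turning_split_add ww aT (tree_same a (e a) tT); rewrite k.
by clear; lia.
Qed.

(** T + a has two contours, and their turnings are opposite because a splits
    the contour of T, which has turning d. *)
Lemma tree_add_zero T a z : tree T -> ~~ on T a -> tau (toggle T a) z = 0 ->
  forall u, tau (toggle T a) u = 0.
Proof.
move=> tT aT kz u; have s := tree_add_sum tT aT.
have [ka kea] : tau (toggle T a) a = 0 /\ tau (toggle T a) (e a) = 0.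
  by case/orP: (tree_add a z tT) => /(turning_same w) az; move: s; rewrite az kz;
    clear; lia.
by case/orP: (tree_add a u tT) => /(turning_same w) <-.
Qed.

Definition joins S g := ~~ on S g && ~~ same S g (e g).

(** The condition on g says that the cycle of T + a is not separating: g leads
    from one side of it to the other. *)
Definition vanishing T := forall a g, ~~ on T a -> joins (toggle T a) g ->
  forall z, tau (toggle T a) z = 0.

(** The two contours of S joined by g have opposite turnings. Removing x
    merges two contours; if g still joins two distinct contours, at least one
    of the two is unaffected. So the turning that S - x has there is, up to
    sign, the one that S - y has. *)
Lemma planar_theta S g x y : level S = 1%N -> joins S g ->
  on S x -> ~~ same S x (e x) -> ~~ same (toggle S x) g (e g) ->
  (forall z, tau (toggle S x) z = 0) ->
  on S y -> ~~ same S y (e y) -> ~~ same (toggle S y) g (e g) ->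
  exists z, tau (toggle S y) z = 0.
Proof.
move=> l1 /andP[gS gs] xS sx gx kx yS sy gy.
have spare u : ~~ same S u (e u) -> ~~ same (toggle S u) g (e g) ->
    exists2 z, z = g \/ z = e g & tau (toggle S u) z = tau S z.
  move=> su; have [ug|ug] := boolP (same S u g || same S (e u) g); last first.
    exists g; first by left.
    by move: ug; rewrite negb_or => /andP[? ?]; rewrite turning_other.
  have [ueg|ueg] := boolP (same S u (e g) || same S (e u) (e g)); last first.
    exists (e g); first by right.
    by move: ueg; rewrite negb_or => /andP[? ?]; rewrite turning_other.
  by rewrite -(same_l (x := u)) ?same_merge ?ueg.
have sum := joining_sum euler ang ww l1 gS gs.
have [z zE kz] := spare x sx gx; rewrite kx in kz.
have [kg keg] : tau S g = 0 /\ tau S (e g) = 0.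
  by case: zE kz sum => -> <-; clear; lia.
by have [u [->|->] ku] := spare y sy gy; [exists g|exists (e g)]; rewrite ku.
Qed.

End Trees.

(** * Fundamental cycles of one tree *)

Section FundamentalCycles.
Variables (D : finType) (M : cmap D).
Notation N := (next M).
Notation e := (edge M).
Implicit Types S T : edge_set M.
Hypothesis euler : nverts M + nfaces M = nedges M.

Lemma exists_third S a b : 2 < ncontours S ->
  exists2 z, ~~ same S a z & ~~ same S b z.
Proof.
rewrite ncontours_perm; set s := perm _ => lt.
have : 0 < #|porbits s :\ porbit s a :\ porbit s b|.
  move: lt; rewrite (cardsD1 (porbit s a)) (cardsD1 (porbit s b) (_ :\ _)).
  by do 2!case: (_ \in _) => /=; clear; lia.
case/card_gt0P=> A; rewrite !inE => /and3P[Ab Aa /imsetP[z _ Az]].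
by exists z; rewrite same_perm porbit_sym -eq_porbit_mem -Az eq_sym.
Qed.

Lemma ncontours_tree_add T a : tree T -> ncontours (toggle T a) = 2.
Proof.
by move=> tT; rewrite ncontours_split ?tree_same //; case/andP: tT => /eqP->.
Qed.

(** The fundamental cycle of a has its two contours on its two sides, so this
    says that b leaves it on one side and comes back on the other: the
    fundamental cycles of a and b cross once. *)
Definition cross T a b := ~~ same (toggle T a) b (e b).

Lemma crossE T a b : tree T -> cross T a b = (ncontours (toggle (toggle T a) b) == 1).
Proof.
move=> tT; rewrite /cross; have c := ncontours_tree_add a tT.
have [s|s] := boolP (same _ _ _).
  by rewrite (ncontours_split s) c.
by have := ncontours_merge s; rewrite c => -[<-].
Qed.

Lemma crossC T a b : tree T -> cross T a b = cross T b a.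
Proof. by move=> tT; rewrite !crossE // toggleC. Qed.

Lemma off_toggle S a b : ~~ on S b -> b != a -> b != e a -> ~~ on (toggle S a) b.
Proof. by rewrite on_toggle => /negbTE-> /negbTE-> /negbTE->. Qed.

Lemma off_toggleK S a b : ~~ on S a -> ~~ on (toggle S a) b ->
  [/\ ~~ on S b, b != a & b != e a].
Proof.
move=> aS; rewrite on_toggle.
have [->|ba] := eqVneq b a; first by rewrite (negbTE aS).
have [->|bea] := eqVneq b (e a); first by rewrite onE (negbTE aS).
by rewrite addbF.
Qed.

Variables (d : nat) (w : D -> int).
Local Open Scope ring_scope.
Hypothesis ang : angulation M d.
Hypothesis ww : weighting M d w.
Local Notation tau := (turning w).

(** Two essential fundamental cycles that do not cross: T + a + c is planar,
    and planar_theta transfers the turning from its cycle a to its cycle c. *)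
Lemma vanishing_planar T a b c g : tree T -> ~~ on T a ->
  joins (toggle T a) b -> (forall z, tau (toggle T a) z = 0) ->
  ~~ on (toggle T a) c -> ~~ cross T a c -> joins (toggle T c) g ->
  forall z, tau (toggle T c) z = 0.
Proof.
move=> tT aT /andP[bTa sb] ka cTa nac /andP[gTc sg].
have [cT ca cea] := off_toggleK aT cTa; have [gT gc gec] := off_toggleK cT gTc.
have [bT ba bea] := off_toggleK aT bTa.
have sc : same (toggle T a) c (e c) by apply/negPn.
have sa : same (toggle T c) a (e a) by rewrite crossC // in nac; apply/negPn.
pose S := toggle (toggle T a) c.
have Sc : toggle S c = toggle T a by rewrite toggleK.
have Sa : toggle S a = toggle T c by rewrite /S toggleC toggleK.
have nc : ~~ same S c (e c) by apply: not_same_toggle.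
have na : ~~ same S a (e a) by rewrite /S toggleC; apply: not_same_toggle.
have l1 : level S = 1%N.
  by rewrite level_split_add // tree_add_level.
have ga : g != a by apply: contraNneq sg => ->.
have gea : g != e a by apply: contraNneq sg => ->; rewrite edgeK sameC.
have bc : b != c by apply: contraNneq sb => ->.
have bec : b != e c by apply: contraNneq sb => ->; rewrite edgeK sameC.
have gS : ~~ on S g by rewrite !off_toggle.
have bS : ~~ on S b by rewrite off_toggle.
have gs : ~~ same S g (e g).
  by apply: contra sg => /(same_toggle_mono na); rewrite Sa.
have bs : ~~ same S b (e b).
  by apply: contra sb => /(same_toggle_mono nc); rewrite Sc.
have mono u v : same S u v -> same (toggle T a) u v.
  by move/(same_toggle_mono nc); rewrite Sc.
have gTa : ~~ same (toggle T a) g (e g).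
  case: (joining_pair euler l1 gS gs bS bs) => -[/mono h1 /mono h2].
    by rewrite (same_l h1) (same_r _ h2).
  by rewrite (same_l h1) (same_r _ h2) sameC.
have [z kz] : exists z, tau (toggle S a) z = 0.
  apply: (@planar_theta _ _ euler d w ang ww S g c a) => //.
  - exact/andP.
  - by rewrite toggle_self.
  - by rewrite Sc.
  - by move=> z; rewrite Sc.
  - rewrite /S toggleC toggle_self off_toggle // 1?eq_sym //.
    by rewrite edge_eqC.
  - by rewrite Sa.
by rewrite Sa in kz; apply: (tree_add_zero euler ww tT cT kz).
Qed.

(** Two crossing fundamental cycles are enough. A third essential one fails to
    cross one of them, or the three cross pairwise and hexagon applies. *)
Lemma vanishing_base T a b : tree T -> ~~ on T a -> joins (toggle T a) b ->
  (forall z, tau (toggle T a) z = 0) -> (forall z, tau (toggle T b) z = 0) ->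
  vanishing w T.
Proof.
move=> tT aT jb ka kb c g cT jg.
have [->//|ca] := eqVneq c a.
have [->|cea] := eqVneq c (e a); first by rewrite toggle_edge.
have [->//|cb] := eqVneq c b.
have [->|ceb] := eqVneq c (e b); first by rewrite toggle_edge.
have /andP[bTa xab] := jb; have [bT ba bea] := off_toggleK aT bTa.
have ja : joins (toggle T b) a.
  rewrite /joins off_toggle //= 1?eq_sym //; last by rewrite edge_eqC.
  by move: xab; rewrite -/(cross T a b) crossC.
have [xac|nac] := boolP (cross T a c); last first.
  exact: (vanishing_planar tT aT jb ka (off_toggle cT ca cea) nac jg).
have [xbc|nbc] := boolP (cross T b c); last first.
  exact: (vanishing_planar tT bT ja kb (off_toggle cT cb ceb) nbc jg).
have [c1 l1] : ncontours T = 1%N /\ level T = 1%N by case/andP: tT => /eqP-> /eqP->.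
have [h kh] : exists h, tau (toggle T c) h = 0.
  apply: (@hexagon _ _ d w ww.1 T a b c) => //.
    by rewrite (negbTE bT) (negbTE cT).
  move=> h; have [-> _] : disc d w (toggle (toggle (toggle T a) b) c) h.
    apply: (disc_level0 euler ang ww).
    have l0 : level (toggle (toggle T a) b) = 0%N.
      by have := level_merge_add euler bTa xab; rewrite tree_add_level // => -[].
    have oc : ~~ on (toggle (toggle T a) b) c by rewrite !off_toggle.
    by rewrite level_split_add // level0_same.
  by rewrite /toggle_gain (negbTE bT).
exact: (tree_add_zero euler ww tT cT kh).
Qed.

End FundamentalCycles.

(** * From one spanning tree to all *)

Section Exchange.
Variables (D : finType) (M : cmap D).
Notation N := (next M).
Notation e := (edge M).
Implicit Types S T : edge_set M.
Hypothesis euler : nverts M + nfaces M = nedges M.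
Hypothesis D_gt0 : 0 < #|D|.
Variables (d : nat) (w : D -> int).
Local Open Scope ring_scope.
Hypothesis ang : angulation M d.
Hypothesis ww : weighting M d w.
Local Notation tau := (turning w).

Lemma ncontours_same S y : (ncontours (toggle S y) < ncontours S)%N -> ~~ same S y (e y).
Proof. by apply: contraL => s; rewrite (ncontours_split s) -leqNgt leqW. Qed.

Section OneExchange.
Variables (T : edge_set M) (t x : D).
Hypotheses (tT : tree T) (t_on : on T t) (x_off : ~~ on T x).
Let K := toggle T t.
Hypothesis x_joins : ~~ same K x (e x).
Let T' := toggle K x.

Lemma exchange_tree : tree T'.
Proof.
have fK := forest_del euler (tree_forest tT) t_on.
have [fT' _] := forest_add euler fK x_joins.
apply: forest_tree => //; have := ncontours_merge x_joins.
have := ncontours_split (tree_same t (e t) tT); case/andP: tT => /eqP -> _ -> [<-] //.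
Qed.

(** Removing t leaves two components, so two of any three darts lie in the
    same. *)
Lemma exchange_two a b c : [\/ same K a b, same K b c | same K a c].
Proof.
have nt : ~~ same K t (e t) by apply: not_same_toggle; apply: tree_same.
have tz z : same K t z || same K (e t) z.
  by rewrite -same_merge // toggleK tree_same.
case/orP: (tz a) => ta; case/orP: (tz b) => tb; case/orP: (tz c) => tc.
- by constructor 1; rewrite -(same_l ta).
- by constructor 1; rewrite -(same_l ta).
- by constructor 3; rewrite -(same_l ta).
- by constructor 2; rewrite -(same_l tb).
- by constructor 2; rewrite -(same_l tb).
- by constructor 3; rewrite -(same_l ta).
- by constructor 1; rewrite -(same_l ta).
- by constructor 1; rewrite -(same_l ta).
Qed.

Variable f : D.
Hypotheses (f_off : ~~ on T f) (fx : f != x) (fex : f != e x).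
Hypothesis van : vanishing w T.
Let S := toggle (toggle T x) f.

Let xt : x != t. Proof. by apply: contraNneq x_off => ->. Qed.
Let xet : x != e t. Proof. by apply: contraNneq x_off => ->; rewrite onE. Qed.
Let ft : f != t. Proof. by apply: contraNneq f_off => ->. Qed.
Let fet : f != e t. Proof. by apply: contraNneq f_off => ->; rewrite onE. Qed.
Let flip (u v : D) : u != v -> v != u. Proof. by rewrite eq_sym. Qed.
Let flipe (u v : D) : u != e v -> v != e u.
Proof. by move=> uv; rewrite eq_sym edge_eqC. Qed.
Let Sf : toggle S f = toggle T x. Proof. exact: toggleK. Qed.
Let Sx : toggle S x = toggle T f. Proof. by rewrite /S toggleC toggleK. Qed.
Let St : toggle S t = toggle T' f.
Proof. by rewrite /S /T' /K toggleC; congr toggle; rewrite toggleC. Qed.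
Let f_on : on S f. Proof. by rewrite toggle_self off_toggle. Qed.
Let x_on : on S x.
Proof. by rewrite /S toggleC toggle_self off_toggle //; [exact: flip|exact: flipe]. Qed.
Let t_onS : on S t.
Proof.
have := flip xt; have := flipe xet; have := flip ft; have := flipe fet.
by rewrite /S !on_toggle t_on; do 4!move/negbTE ->.
Qed.

(** If x and f do not cross, S = T + x + f is planar with three contours. Its
    subgraphs S - x, S - f and S - t are T + f, T + x and T' + f. When g joins
    the two contours of T + f or of T + x, planar_theta transfers their
    turning to T' + f. One of the two cases occurs: otherwise both x and f
    would lie between the two contours joined by g, and the third contour of S
    would remain one of T = S - x - f, which has only one. *)
Lemma exchange_planar g : ~~ cross T x f -> joins (toggle T' f) g ->
  exists z, tau (toggle T' f) z = 0.
Proof.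
move=> nxf /andP[gT'f sg].
have c3 : ncontours S = 3%N.
  by rewrite ncontours_split ?ncontours_tree_add //; apply/negPn.
have l1 : level S = 1%N.
  by rewrite level_split_add ?off_toggle ?tree_add_level //; apply/negPn.
have nt : ~~ same S t (e t).
  by apply: ncontours_same; rewrite St c3 ncontours_tree_add // exchange_tree.
have nx : ~~ same S x (e x).
  by apply: ncontours_same; rewrite Sx c3 ncontours_tree_add.
have nf : ~~ same S f (e f).
  by apply: ncontours_same; rewrite Sf c3 ncontours_tree_add.
have gt_ : g != t.
  apply: contraNneq sg => ->; apply/negPn/negP => sg.
  by have := ncontours_merge sg; rewrite -St toggleK c3 St ncontours_tree_add // exchange_tree.
have get : g != e t.
  apply: contraNneq sg => ->; rewrite edgeK sameC; apply/negPn/negP => sg.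
  by have := ncontours_merge sg; rewrite -St toggleK c3 St ncontours_tree_add // exchange_tree.
have gS : ~~ on S g by rewrite -[S](toggleK _ t) St off_toggle.
have gs : ~~ same S g (e g).
  by apply: contra sg => /(same_toggle_mono nt); rewrite St.
have ju u : on S u -> ~~ on (toggle S u) g.
  by move=> uS; apply: off_toggle => //; apply: contraNneq gS => ->; rewrite ?onE.
have use u : on S u -> ~~ same S u (e u) -> ~~ same (toggle S u) g (e g) ->
    (forall z, tau (toggle S u) z = 0) -> exists z, tau (toggle T' f) z = 0.
  move=> uS su gu ku; rewrite -St.
  apply: (@planar_theta _ _ euler d w ang ww S g u t) => //; first exact/andP.
  by rewrite St.
have [gx|gx] := boolP (same (toggle S x) g (e g)); last first.
  apply: (use x) => //; rewrite Sx in gx *.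
  apply: (van (g := g)) => //; apply/andP; split=> //.
  by have := ju x x_on; rewrite Sx.
have [gf|gf] := boolP (same (toggle S f) g (e g)); last first.
  apply: (use f) => //; rewrite Sf in gf *.
  apply: (van (g := g)) => //; apply/andP; split=> //.
  by have := ju f f_on; rewrite Sf.
have [z gz egz] : exists2 z, ~~ same S g z & ~~ same S (e g) z.
  by apply: exists_third; rewrite c3.
have away u : ~~ same S u (e u) -> same (toggle S u) g (e g) ->
    ~~ same S u z /\ ~~ same S (e u) z.
  move=> nu /(same_unmerge nu)[|[h1 h2]|[h1 h2]]; first by move/negP: gs.
    by rewrite (same_l h1) (same_l h2).
  by rewrite (same_l h1) (same_l h2).
have [xz exz] := away x nx gx; have [fz efz] := away f nf gf.
have fz' : ~~ same (toggle S x) f z by rewrite sameC same_other // sameC.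
have efz' : ~~ same (toggle S x) (e f) z by rewrite sameC same_other // sameC.
have := tree_same z g tT; rewrite -[T](toggleK _ f) -Sx.
by rewrite (same_other _ fz' efz') (same_other _ xz exz) sameC (negbTE gz).
Qed.

(** If f has both ends in one component of the forest K = T - t, the cycle of
    T' + f is that of T + f: in both graphs the other component is attached to
    K + f as a tree, which changes no turning. *)
Lemma exchange_inside : cross T x f -> same K f (e f) ->
  exists z, tau (toggle T' f) z = 0.
Proof.
move=> xf sf; pose R := toggle K f.
have Rx : toggle R x = toggle T' f by rewrite /R toggleC.
have Rt : toggle R t = toggle T f by rewrite /R /K toggleC toggleK.
have fK : ~~ on K f by apply: off_toggle.
have xK : ~~ on K x by apply: off_toggle.
have xR : ~~ on R x by apply: off_toggle => //; [exact: flip|exact: flipe].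
have tK : ~~ on K t by rewrite toggle_self t_on.
have tR : ~~ on R t by apply: off_toggle => //; [exact: flip|exact: flipe].
have kRt z : tau (toggle R t) z = 0.
  rewrite Rt; apply: (van (g := x)) => //; apply/andP; split.
    by apply: off_toggle => //; [exact: flip|exact: flipe].
  by rewrite -/(cross T f x) crossC.
have pK z : tau K z = d%:Z.
  have [-> //] : treelike d w K z.
  by apply: treelike_forest; rewrite // (forest_del euler (tree_forest tT)).
have nf : ~~ same R f (e f) by apply: not_same_toggle.
have sumf : tau R f + tau R (e f) = 0.
  by have := turning_split_add ww fK sf; rewrite pK -/R; clear; lia.
have back u v : same R u v -> same K u v.
  by move/(same_toggle_mono nf); rewrite toggleK.
have fz z : same K f z -> same R f z || same R (e f) z.
  by move=> h; rewrite -same_merge // toggleK.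
have main u : ~~ on K u -> ~~ on R u -> ~~ same K u (e u) ->
    exists2 v, same K f v & tau (toggle R u) u = tau R v.
  move=> uK uR nu; have nRu : ~~ same R u (e u) by apply: contra nu; apply: back.
  have far v : ~~ same K f v -> tau R v = d%:Z.
    by move=> fv; rewrite turning_other ?pK // -(same_l sf).
  have kRu := turning_merge_add ww uR nRu.
  case: (exchange_two f u (e u)) => [fu|//|fu]; last 1 first.
  - exists (e u) => //; rewrite kRu far; first by clear; lia.
    by apply: contra nu => fu'; rewrite -(same_l fu').
  - exists u => //; rewrite kRu (far (e u)); first by clear; lia.
    by apply: contra nu => fu'; rewrite -(same_l fu).
  - by move/negP: nu.
have nt : ~~ same K t (e t) by apply: not_same_toggle; apply: tree_same.
have [v fv kv] := main t tK tR nt; rewrite kRt in kv.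
have [v' fv' kv'] := main x xK xR x_joins.
exists x; rewrite -Rx kv'.
have [kf kef] : tau R f = 0 /\ tau R (e f) = 0.
  by case/orP: (fz v fv) sumf => /(turning_same w) ->; rewrite -kv; clear; lia.
by case/orP: (fz v' fv') => /(turning_same w) <-.
Qed.

(** If x and f cross and both, like t, join the two components of K, then x, f
    and t are three pairwise crossing removals from T + x + f. *)
Lemma exchange_hexagon : cross T x f -> ~~ same K f (e f) ->
  exists z, tau (toggle T' f) z = 0.
Proof.
move=> xf nf; have c1 : ncontours S = 1%N by apply/eqP; rewrite -crossE.
rewrite -St; apply: (@hexagon _ _ d w ww.1 S x f t) => //.
- exact: flip.
- exact: flipe.
- exact: flip.
- exact: flipe.
- by rewrite Sx; apply: not_same_toggle; apply: tree_same.
- apply: ncontours_same; rewrite Sx (ncontours_tree_add f tT) toggleC -/K.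
  have := ncontours_merge nf; have := ncontours_split (tree_same t (e t) tT).
  by case/andP: tT => /eqP -> _; rewrite -/K => ->; clear; lia.
- apply: ncontours_same; rewrite Sf (ncontours_tree_add x tT) toggleC.
  by have /andP[/eqP -> _] := exchange_tree.
- by rewrite f_on t_onS.
- move=> h; rewrite Sx toggleK -/K.
  have [-> _] : treelike d w K h.
    by apply: treelike_forest; rewrite // (forest_del euler (tree_forest tT)).
  by rewrite /toggle_gain f_on.
- move=> h; rewrite Sx; apply: (van (g := x)) => //; apply/andP; split.
    by apply: off_toggle => //; [exact: flip|exact: flipe].
  by rewrite -/(cross T f x) crossC.
- move=> h; rewrite Sf; apply: (van (g := f)) => //; apply/andP; split => //.
  exact: off_toggle.
Qed.

End OneExchange.

Lemma vanishing_exchange T t x : tree T -> on T t -> ~~ on T x ->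
  ~~ same (toggle T t) x (e x) -> vanishing w T ->
  vanishing w (toggle (toggle T t) x).
Proof.
move=> tT tt xT nx van f g fT' jg; set T' := toggle _ x in fT' jg *.
have tT' : tree T' by apply: exchange_tree.
have xK : ~~ on (toggle T t) x.
  by apply: off_toggle; rewrite // ; apply: contraNneq xT => ->; rewrite ?onE.
have T't : toggle T' t = toggle T x by rewrite /T' toggleC toggleK.
have [ft|ft] := eqVneq f t; first by move: jg; rewrite ft T't; apply: van.
have [fet|fet] := eqVneq f (e t).
  by move: jg; rewrite fet toggle_edge T't; apply: van.
have fx : f != x by apply: contraNneq fT' => ->; rewrite toggle_self.
have fex : f != e x by apply: contraNneq fT' => ->; rewrite onE toggle_self.
have fT : ~~ on T f.
  by move: fT'; rewrite !on_toggle (negbTE ft) (negbTE fet) (negbTE fx) (negbTE fex)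
    !addbF.
have [z kz] : exists z, tau (toggle T' f) z = 0.
  have [xf|xf] := boolP (cross T x f); last by apply: exchange_planar jg.
  have [sf|sf] := boolP (same (toggle T t) f (e f)).
    exact: exchange_inside.
  exact: exchange_hexagon.
exact: (tree_add_zero euler ww tT' fT' kz).
Qed.

Lemma card_tree T T' : tree T -> tree T' -> #|val T| = #|val T'|.
Proof.
case/andP=> /eqP c /eqP l /andP[/eqP c' /eqP l'].
have := levelE euler T; have := levelE euler T'; rewrite c l c' l'; clear; lia.
Qed.

(** The exchange property of spanning trees: an edge t of T outside T' can be
    replaced by an edge of T', since T' connects the two components of T - t. *)
Lemma vanishing_all T T' : tree T -> tree T' -> vanishing w T -> vanishing w T'.
Proof.
have [n] := ubnP #|val T' :\: val T|; elim: n T => // n IH T lt tT tT' van.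
have [TT'|] := eqVneq T T'; first by rewrite -TT'.
have cTT' := card_tree tT tT'.
have [sub|/subsetPn[t tT1 tT'1]] := boolP (val T \subset val T').
  case/negP; apply/eqP/val_inj/eqP; rewrite eqEcard sub.
  by rewrite -cTT' leqnn.
move=> _; have tt : on T t by []. have tt' : ~~ on T' t by [].
pose K := toggle T t.
have fK : forest K by apply: forest_del (tree_forest tT) tt.
have c2 : ncontours K = 2%N.
  by rewrite ncontours_split ?tree_same //; case/andP: tT => /eqP ->.
(* If no edge of T' joined the two contours of K, the single contour of T'
   would stay inside one of them. *)
have [x xT' nx] : exists2 x, on T' x & ~~ same K x (e x).
  apply/exists_inP; apply: contraT; rewrite negb_exists_in => /forall_inP s.
  have : (1 < ncontours K)%N by rewrite c2.
  case/ncontours_gt1P=> a [b /negP[]].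
  have Ke y : on K y -> same K a y -> same K a (e y).
    by move=> yK ay; apply: same_trans ay _; apply: forest_same.
  have KN y : same K a y -> same K a (N y).
    move=> ay; have [yK|yK] := boolP (on K y); last first.
      by rewrite -(contour_next_off yK); apply: same_trans ay (same_next _ _).
    rewrite -[y](edgeK M) -/(face M (e y)) -(@contour_next_on _ _ K) ?onE //.
    by apply: same_trans (same_next _ _); apply: Ke.
  have : same T' a b by apply: tree_same.
  move/iter_findex <-; elim: (findex _ _ _) => [|m IHm] /=; first exact: same_refl.
  rewrite /contour_next; case: ifP => oT'; apply: KN => //.
  by apply: same_trans IHm _; have := s _ oT'; rewrite negbK.
have xT : ~~ on T x.
  have [_ xK] := forest_add euler fK nx.
  apply: contra xK => xT; rewrite on_toggle xT.
  case: eqP => [xt|_]; first by rewrite xt (negbTE tt') in xT'.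
  by case: eqP => [xt|_] //; rewrite xt onE (negbTE tt') in xT'.
apply: (IH (toggle K x)) => //; last exact: vanishing_exchange.
  rewrite -ltnS; apply: leq_trans lt; rewrite ltnS; apply: proper_card; apply/properP; split.
    apply/subsetP=> y; rewrite !inE -!/(on _ _) => /andP[yn yT'].
    rewrite yT' andbT; apply: contra yn => yT; rewrite !on_toggle yT.
    have yt : y != t by apply: contraNneq tt' => <-.
    have yet : y != e t by apply: contraNneq tt' => h; rewrite -onE -h.
    have yx : y != x by apply: contraNneq xT => <-.
    have yex : y != e x by apply: contraNneq xT => h; rewrite -onE -h.
    by rewrite (negbTE yt) (negbTE yet) (negbTE yx) (negbTE yex).
  exists x; rewrite in_setD -!/(on _ _) ?xT ?xT' //.
  by rewrite toggle_self; have [_ ->] := forest_add euler fK nx.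
exact: exchange_tree.
Qed.

End Exchange.

(** * Arbitrary contours *)

Section Linked.
Variables (D : finType) (M : cmap D).
Notation N := (next M).
Notation e := (edge M).
Implicit Types S T : edge_set M.

(** Rotations are free, so this is connectedness of vertices in the graph with
    edges S. *)
Definition linked S := connect [rel a b | (b == N a) || on S a && (b == e a)].

Lemma linked_trans S a b c : linked S a b -> linked S b c -> linked S a c.
Proof. exact: connect_trans. Qed.

Lemma linked_next S a : linked S a (N a).
Proof. by apply: connect1; rewrite /= eqxx. Qed.

Lemma linked_edge S a : on S a -> linked S a (e a).
Proof. by move=> aS; apply: connect1; rewrite /= aS eqxx orbT. Qed.

Lemma linked_sym S a b : linked S a b = linked S b a.
Proof.
suff sym u v : linked S u v -> linked S v u by apply/idP/idP; apply: sym.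
case/connectP=> p + ->; elim: p u => [|k p IH] u /=; first by move=> _; exact: connect0.
case/andP=> uk /IH kp; apply: linked_trans kp _.
case/orP: uk => [/eqP->|/andP[uS /eqP->]]; last first.
  by rewrite -{2}[u](edgeK M); apply: linked_edge; rewrite onE.
have := fconnect1 N u; rewrite (fconnect_sym (@next_inj _ M)).
apply: connect_sub => x y /eqP <-; exact: linked_next.
Qed.

Lemma linked_same S a b : same S a b -> linked S a b.
Proof.
move/iter_findex <-; elim: (findex _ _ _) => [|m IH] /=; first exact: connect0.
apply: linked_trans IH _; set u := iter _ _ _.
rewrite /contour_next; case: ifP => [uS|_]; last exact: linked_next.
by apply: linked_trans (linked_edge uS) (linked_next _ _).
Qed.

Lemma linked_closed S (A : pred D) a b : linked S a b -> A a ->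
  (forall y, A y -> A (N y)) -> (forall y, on S y -> A y -> A (e y)) -> A b.
Proof.
move=> + Aa AN Ae; case/connectP=> p + ->; elim: p a Aa => [|k p IH] a Aa //=.
case/andP=> /orP[/eqP->|/andP[aS /eqP->]]; apply: IH; first exact: AN.
exact: Ae.
Qed.

(** A component is generated by rotations and by edges of S, and contour_next
    provides the rotations once the edges are available. *)
Lemma same_closed S a b : (forall y, on S y -> same S a y -> same S a (e y)) ->
  linked S a b -> same S a b.
Proof.
move=> cl ab; apply: (linked_closed ab) => //; first exact: same_refl.
move=> y ay; have [yS|yS] := boolP (on S y); last first.
  by rewrite -(contour_next_off yS); apply: same_trans ay (same_next _ _).
rewrite -[y](edgeK M) -/(face M (e y)) -(@contour_next_on _ _ S) ?onE //.
by apply: same_trans (same_next _ _); apply: cl.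
Qed.

Lemma linked_add S y a b : ~~ on S y -> linked S a b -> linked (toggle S y) a b.
Proof.
move=> yS; apply: connect_sub => u v /= /orP[/eqP->|/andP[uS /eqP->]].
  exact: linked_next.
apply: linked_edge; rewrite on_toggle uS.
case: eqP => [uy|_]; first by rewrite -uy uS in yS.
by case: eqP => [uy|_] //; rewrite uy onE (negbTE yS) in uS.
Qed.

(** Between two distinct contours x is not a bridge: after its removal the
    merged contour still passes through both its ends. *)
Lemma linked_del S x a b : ~~ same S x (e x) -> linked S a b ->
  linked (toggle S x) a b.
Proof.
move=> sx; have xex := linked_same (same_toggle sx).
apply: connect_sub => u v /= /orP[/eqP->|/andP[uS /eqP->]].
  exact: linked_next.
have [->//|ux] := eqVneq u x.
have [->|uex] := eqVneq u (e x); first by rewrite edgeK; move: xex; rewrite linked_sym.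
by apply: linked_edge; rewrite on_toggle uS (negbTE ux) (negbTE uex).
Qed.

Lemma spanning_joining S h : (forall z, linked S h z) -> 1 < ncontours S ->
  forall u, exists2 x, on S x && same S u x & ~~ same S u (e x).
Proof.
move=> sp c1 u; case: (pickP (fun x => [&& on S x, same S u x & ~~ same S u (e x)])).
  by move=> x /and3P[? ? ?]; exists x; rewrite // ; apply/andP.
move=> no; case/ncontours_gt1P: c1 => a [b /negP[]].
have all_u z : same S u z.
  have uz : linked S u z by apply: (@linked_trans S _ h); rewrite // linked_sym.
  by apply: (same_closed _ uz) => y yS uy; have := no y; rewrite yS uy => /negbFE.
by rewrite -(same_l (all_u a)).
Qed.

Hypothesis euler : nverts M + nfaces M = nedges M.
Hypothesis connected :
  forall x y : D, connect [rel a b | (b == e a) || (b == N a)] x y.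
Hypothesis D_gt0 : 0 < #|D|.

(** Remove edges between distinct contours, which keeps both the component and
    the level, until one contour is left; it then bounds the level. *)
Lemma linked_level S h : (forall z, linked S h z) -> level S <= 1.
Proof.
have [n] := ubnP (ncontours S); elim: n S => // n IH S lt sp.
have := ncontours_gt0 D_gt0 S; rewrite leq_eqVlt => /orP[/eqP c|c].
  by have := level_le euler S; rewrite -c.
have [x /andP[xS hx] nhx] := spanning_joining sp c h.
have sx : ~~ same S x (e x) by rewrite -(same_l hx).
rewrite -(level_merge_del euler xS sx); apply: IH.
  by have := ncontours_merge sx; lia.
by move=> z; apply: linked_del.
Qed.

Variables (d : nat) (w : D -> int).
Local Open Scope ring_scope.
Hypothesis ang : angulation M d.
Hypothesis ww : weighting M d w.
Local Notation tau := (turning w).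
Local Notation disc := (disc d w).
Local Notation treelike := (treelike d w).

(** By turning_merge and null_contour_merge, the contour of a tree to which an
    edge is added, or a disc from which an edge is removed, contributes
    nothing to the contour on the other side of the edge. *)
Lemma absorb S x h : ~~ same S x (e x) -> ~~ same S x h ->
  tau S x = (if on S x then - d%:Z else d%:Z) -> null_contour S x ->
  tau (toggle S x) h = tau S h /\ (null_contour (toggle S x) h <-> null_contour S h).
Proof.
move=> sx xh kx cx.
have [eh|eh] := boolP (same S (e x) h); last by rewrite turning_other // null_contour_other.
have sex : ~~ same S (e x) (e (e x)) by rewrite edgeK sameC.
have eh' : same (toggle S x) (e x) h by apply: same_toggle_mono.
rewrite -(turning_same w eh) -(turning_same w eh') -(toggle_edge S x) (turning_merge ww.1 sex).
rewrite edgeK onE kx; split; first by case: (on S x); clear; lia.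
have he : same S h (e x) by rewrite sameC.
have he' : same (toggle S (e x)) h (e x) by rewrite toggle_edge sameC.
have cx' : null_contour S (e (e x)) by rewrite edgeK.
have [c1 c2] := null_contour_merge sex cx'.
split=> c.
  by apply: (null_contour_same eh); apply: c1; apply: null_contour_same he' c.
have := c2 (null_contour_same he c); apply: null_contour_same.
by rewrite toggle_edge.
Qed.

(** The component of z is a plane tree, with its unique contour. *)
Definition rooted S z := treelike S z /\
  forall y, on S y -> same S z y -> same S z (e y).

(** Tree components are attached one by one by a missing edge. The other end
    of the edge lies on the component of h, which absorbs the tree, or on
    another tree, and the two become one. *)
Lemma grow S h : (forall z, linked S h z \/ rooted S z) ->
  exists S', [/\ forall z, linked S' h z, tau S' h = tau S h
    & null_contour S' h -> null_contour S h].
Proof.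
have [n] := ubnP (ncontours S); elim: n S => // n IH S lt J.
case: (pickP (fun z => ~~ linked S h z)) => [z hz|all_h]; last first.
  by exists S; split=> // z; apply/negbFE/all_h.
have [|[pz cz]] := J z; first by rewrite (negbTE hz).
have [y /andP[zy zey]] : exists y, same S z y && ~~ same S z (e y).
  apply/existsP; apply: contraT; rewrite negb_exists => /forallP no.
  case/negP: hz; rewrite linked_sym; apply: linked_same.
  apply: (closed_everything connected (S := S) (z := z)); first exact: same_refl.
    by move=> u zu; apply: same_trans zu (same_next _ _).
  by move=> u zu; have := no u; rewrite zu negbK.
have yS : ~~ on S y by apply: contra zey => /cz; apply.
have sy : ~~ same S y (e y) by rewrite -(same_l zy).
have hy : ~~ linked S h y.
  by apply: contra hz => hy; apply: linked_trans hy _; rewrite linked_sym linked_same.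
have yh : ~~ same S y h by apply: contra hy => /linked_same; rewrite linked_sym.
have [ky cy] := treelike_same zy pz.
have ky' : tau S y = if on S y then - d%:Z else d%:Z by rewrite (negbTE yS).
have [kh ch] := absorb sy yh ky' cy.
have [|z'|S' [sp k' c']] := IH (toggle S y).
- by have := ncontours_merge sy; lia.
- have [lz'|lz'] := boolP (linked S h z'); first by left; apply: linked_add.
  have tz' : rooted S z' by case: (J z') => // l; rewrite l in lz'.
  have [yz'|yz'] := boolP (same (toggle S y) y z'); last first.
    move: (yz'); rewrite same_merge // negb_or => /andP[y1 y2]; right; split.
      by apply/treelike_other => //; case: tz'.
    move=> u; rewrite on_toggle !(same_other _ y1 y2) => uS zu.
    have uy : u != y by apply: contraNneq y1 => <-; rewrite sameC.
    have uey : u != e y by apply: contraNneq y2 => <-; rewrite sameC.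
    by apply: tz'.2 => //; move: uS; rewrite (negbTE uy) (negbTE uey) addbF.
  have [ley|ley] := boolP (linked S h (e y)).
    left; apply: linked_trans (linked_add yS ley) _.
    apply: linked_trans (linked_same yz').
    have := @linked_edge (toggle S y) (e y); rewrite edgeK; apply.
    by rewrite onE toggle_self.
  right; have [pey cey] : rooted S (e y) by case: (J (e y)) => // l; rewrite l in ley.
  split.
    apply: (treelike_same yz'); split; last by apply/null_contour_merge; case: pey.
    by rewrite (turning_merge_add ww yS sy) ky pey.1; clear; lia.
  move=> u uS; rewrite -!(same_l yz') !same_merge // => yu.
  have [->|uy] := eqVneq u y; first by rewrite same_refl orbT.
  have [->|uey] := eqVneq u (e y); first by rewrite edgeK same_refl.
  have {}uS : on S u by move: uS; rewrite on_toggle (negbTE uy) (negbTE uey) addbF.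
  case/orP: yu => yu; last by rewrite (cey u) ?orbT.
  by rewrite -(same_l zy) cz ?(same_l zy).
- exists S'; split=> //; first by rewrite k'.
  by move/c'/ch.
Qed.

Hypothesis van : forall T, tree T -> vanishing w T.

(** If a contour other than that of h is a disc, an edge between the two can
    be removed by absorb; the edge exists because S is connected. So it
    remains to find such a disc or to conclude at once. If no missing edge
    joins two contours, separated_disc applied to h and any other contour
    gives a disc. If g joins two of them, all the others are discs, and when
    there are no others S is a tree plus one edge, with turning 0 by
    assumption. *)
Lemma level1_nonneg_or_disc S h : (forall z, linked S h z) -> level S = 1%N ->
  0 <= tau S h \/ disc S h.
Proof.
have [n] := ubnP (ncontours S); elim: n S => // n IH S lt sp l1.
have := ncontours_gt0 D_gt0 S; rewrite leq_eqVlt => /orP[/eqP c|c].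
  left; have [-> _] : treelike S h by apply: treelike_forest; rewrite // /forest -c l1.
  by [].
suff [k0|[dh|[u hu [ku cu]]]] : 0 <= tau S h \/ disc S h \/
    exists2 u, ~~ same S h u & disc S u.
- by left.
- by right.
- have [x /andP[xS ux] nux] := spanning_joining sp c u.
  have sx : ~~ same S x (e x) by rewrite -(same_l ux).
  have xh : ~~ same S x h by rewrite -(same_l ux) sameC.
  have kx : tau S x = if on S x then - d%:Z else d%:Z.
    by rewrite xS -ku; apply/esym/turning_same.
  have [kh ch] := absorb sx xh kx (null_contour_same ux cu).
  have lt' : (ncontours (toggle S x) < n)%N by have := ncontours_merge sx; lia.
  have sp' z : linked (toggle S x) h z by apply: linked_del.
  have l1' : level (toggle S x) = 1%N by rewrite (level_merge_del euler xS sx).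
  have [k|[k cc]] := IH _ lt' sp' l1'.
  + by left; rewrite -kh.
  + by right; split; [rewrite -kh|apply/ch].
case: (pickP (joins S)) => [g jg|nj]; last first.
  have [u hu] : exists u, ~~ same S h u.
    apply/existsP; apply: contraT; rewrite negb_exists => /forallP al.
    have := c; case/ncontours_gt1P=> a [b /negP[]].
    have sm z : same S h z by have := al z; rewrite negbK.
    by rewrite -(same_l (sm a)).
  right; case: (@separated_disc _ _ euler d w ang ww S h u l1 hu); [|by left|].
    move=> y yS hy; apply: contra hu => uy; have := nj y; rewrite /joins yS /=.
    by move/negbFE => yey; apply: same_trans hy _; apply: same_trans yey _; rewrite sameC.
  by right; exists u.
have /andP[gS sg] := jg.
have third z : ~~ same S g z -> ~~ same S (e g) z -> disc S z.
  exact: joining_third.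
have [hg|hg] := boolP (same S g h || same S (e g) h); last first.
  by right; left; move: hg; rewrite negb_or => /andP[]; apply: third.
have [c3|c2] := ltnP 2 (ncontours S).
  have [u gu egu] := exists_third g (e g) c3; right; right; exists u; last exact: third.
  by case/orP: hg => hg; rewrite -(same_l hg).
have {}c2 : ncontours S = 2%N by apply/eqP; rewrite eqn_leq c2 c.
have [x /andP[xS ux] nux] := spanning_joining sp c h.
have sx : ~~ same S x (e x) by rewrite -(same_l ux).
have tT : tree (toggle S x).
  rewrite /tree (level_merge_del euler xS sx) l1 andbT.
  by have := ncontours_merge sx; rewrite c2 => -[<-].
left; have := @van _ tT x g; rewrite toggleK toggle_self xS => -> //.
Qed.

(** All edges of S meet the contour of h, so that the components of S are that
    of h and isolated vertices, which grow absorbs. *)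
Lemma contour_nonneg_or_disc S h :
  (forall y, on S y -> same S h y || same S h (e y)) ->
  0 <= tau S h \/ disc S h.
Proof.
move=> mi; have [|S' [sp k c]] := @grow S h.
  move=> z; have [lz|lz] := boolP (linked S h z); [by left|right].
  have off y : same S z y -> ~~ on S y.
    move=> zy; apply: contra lz => yS; apply: (@linked_trans S _ y).
      case/orP: (mi y yS) => /linked_same // hy.
      apply: linked_trans hy _; rewrite -{2}[y](edgeK M).
      by apply: linked_edge; rewrite onE.
    by rewrite linked_sym linked_same.
  split; first exact: (treelike_vertex ww).
  by move=> y yS /off; rewrite yS.
have := linked_level sp; rewrite leq_eqVlt ltnS leqn0 => /orP[]/eqP l.
  by case: (level1_nonneg_or_disc sp l) => [k0|[kd cd]]; [left|right; split];
    rewrite -?k //; apply: c.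
by have [kd cd] := disc_level0 euler ang ww h l; right; split; [rewrite -k|apply: c].
Qed.

End Linked.

(** * Choosing integer weights *)

Section Weights.
Variables (D : finType) (M : cmap D).
Notation N := (next M).
Notation e := (edge M).
Implicit Types S T : edge_set M.
Hypothesis euler : nverts M + nfaces M = nedges M.
Hypothesis D_gt0 : 0 < #|D|.
Variables (d : nat).
Local Open Scope ring_scope.
Hypothesis ang : angulation M d.

Definition at_vertex z x : bool := fconnect N z x.

Lemma at_vertex_next z x : at_vertex z (N x) = at_vertex z x.
Proof. by rewrite /at_vertex -(same_fconnect1_r (@next_inj _ M)). Qed.

Lemma sum_vertex (f : D -> int) z :
  \sum_(y <- orbit N z) f y = \sum_(y | at_vertex z y) f y.
Proof.
rewrite big_uniq ?orbit_uniq //; apply: eq_bigl => y.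
by rewrite /at_vertex fconnect_orbit.
Qed.

Lemma sum_indicator (f : D -> int) (P : pred D) x :
  \sum_(y | P y) (if y == x then f y else 0) = if P x then f x else 0.
Proof.
rewrite -big_mkcondr /=; case: ifP => Px; last first.
  by rewrite big1 // => y /andP[Py /eqP yx]; rewrite -yx Py in Px.
by rewrite (big_pred1 x) // => y; rewrite /= andb_idl // => /eqP ->.
Qed.

(** A unit flow from x to y along a walk in T. Being antisymmetric, it can be
    added to weights without changing those of the edges. *)
Lemma tree_flow T x y : linked T x y -> exists phi : D -> int,
  [/\ forall h, phi h + phi (e h) = 0, forall h, ~~ on T h -> phi h = 0
   & forall z, \sum_(h <- orbit N z) phi h = (at_vertex z x)%:Z - (at_vertex z y)%:Z].
Proof.
case/connectP=> p + ->; elim: p x => [|k p IH] x /=.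
  move=> _; exists (fun=> 0); split=> // z.
  by rewrite big1 // subrr.
case/andP=> xk /IH[phi [as_ off div]].
case/orP: xk => [/eqP kx|/andP[xT /eqP kx]].
  by exists phi; split=> // z; rewrite div kx at_vertex_next.
pose psi h : int := (if h == x then 1 else 0) - (if h == e x then 1 else 0).
exists (fun h => psi h + phi h); split=> [h|h hT|z].
- rewrite addrACA as_ addr0 /psi (edge_eqC M h x) (edge_eqC M h (e x)) edgeK.
  by rewrite addrACA -opprD [X in _ - X]addrC subrr.
- rewrite off // addr0 /psi.
  case: eqP => [hx|_]; first by rewrite hx xT in hT.
  by case: eqP => [hx|_]; first by rewrite hx onE xT in hT.
rewrite big_split /= div kx sum_vertex /psi sumrB.
rewrite (sum_indicator (fun=> 1)) (sum_indicator (fun=> 1)).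
by case: (at_vertex z x); case: (at_vertex z (e x)); rewrite /= ?subrr ?addr0 ?sub0r
  ?subr0 ?addNr ?add0r // ?addrA ?subrr ?addNr ?add0r.
Qed.

Lemma turning_ext w w' S x : (forall h, ~~ on S h -> w h = w' h) ->
  turning w S x = turning w' S x.
Proof.
move=> ww'; apply: eq_bigr => h _; rewrite /dart_cost.
by case: ifP => // /negbT /ww'.
Qed.

Lemma sum_edges (w : D -> int) (c : int) : (forall h, w h + w (e h) = c) ->
  \sum_h w h = (nedges M)%:Z * c.
Proof.
move=> we; have we2 : \sum_h w h + \sum_h w (e h) = c *+ #|D|.
  by rewrite -big_split /= -sumr_const; apply: eq_bigr => h _; apply: we.
have eE : \sum_h w (e h) = \sum_h w h.
  by rewrite [RHS](reindex_inj (@edge_inj _ M)).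
move: we2; rewrite eE (card_darts M) -mulr_natr natrM.
rewrite !natz; clear; lia.
Qed.

Lemma card_faces : (d * nfaces M = 2 * nedges M)%N.
Proof.
rewrite -(card_darts M) mulnC; apply: (fcard_order_set (@face_inj _ M)) => //.
by apply/subsetP=> x _; rewrite inE ang.
Qed.

Lemma sum_roots z :
  \sum_(h | at_vertex z h) (if froots N h then d%:Z else 0) = d%:Z.
Proof.
have sym := fconnect_sym (@next_inj _ M); rewrite -big_mkcondr /=.
rewrite (big_pred1 (froot N z)) // => h; rewrite /= /at_vertex.
apply/andP/eqP => [[zh /eqP <-]|->]; first exact/esym/rootP.
by rewrite roots_root // connect_root.
Qed.

(** The defects of the vertices sum to 0: with V, E, F vertices, edges and
    faces, the total weight is E (d - 2), and V + F = E with d F = 2 E makes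
    this V d. So flows along T to a common root b repair them, without
    touching darts off T. *)
Lemma balance_vertices T w0 : tree T ->
  (forall h, w0 h + w0 (e h) = d%:Z - 2 :> int) ->
  exists w, weighting M d w /\ forall h, ~~ on T h -> w h = w0 h.
Proof.
move=> tT we0; have /card_gt0P[b _] := D_gt0.
have /choice[phi phiP] x := tree_flow (linked_same (tree_same x b tT)).
(* The wanted weight d of a vertex is put on one representative dart of it. *)
pose c h : int := (if froots N h then d%:Z else 0) - w0 h.
have c_sum : \sum_h c h = 0.
  rewrite sumrB (sum_edges we0) -big_mkcond sumr_const /=.
  have -> : #|[pred h | froots N h]| = nverts M.
    by apply: eq_card => h; rewrite !inE andbT.
  by have := card_faces; have := euler; rewrite -mulr_natr !natz; clear; nia.
exists (fun h => w0 h + \sum_x c x * phi x h); split; last first.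
  move=> h hT; rewrite big1 ?addr0 // => x _.
  by have [_ off _] := phiP x; rewrite off ?mulr0.
split=> [h|z].
  rewrite addrACA we0 -big_split big1 /= ?addr0 // => x _.
  by have [as_ _ _] := phiP x; rewrite -mulrDr as_ mulr0.
have s0 : \sum_x c x * (at_vertex z b)%:Z = 0 by rewrite -mulr_suml c_sum mul0r.
rewrite big_split /= exchange_big /=.
rewrite [X in _ + X](eq_bigr (fun x => (if at_vertex z x then c x else 0) - c x * (at_vertex z b)%:Z)).
  rewrite sumrB s0 subr0 -big_mkcond /= /c sumrB sum_roots.
  by rewrite -sum_vertex addrC subrK.
move=> x _; have [_ _ div] := phiP x; rewrite -mulr_sumr div mulrBr.
by case: (at_vertex z x); rewrite ?mulr1 ?mulr0.
Qed.

(** For crossing a and b, exactly one dart of b lies on a given contour of T +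
    a, so moving weight between the darts of b gives this contour any
    prescribed turning, and the roles of a and b can be exchanged without
    interference: the darts of a are on T + a, where their weights do not
    count. Balancing the vertices then uses darts of T only. *)
Lemma exists_weights T : tree T -> exists w, weighting M d w /\ vanishing w T.
Proof.
move=> tT.
pose w0 h : int := if (enum_rank h < enum_rank (e h))%N then d%:Z - 2 else 0.
have we0 h : w0 h + w0 (e h) = d%:Z - 2.
  rewrite /w0 edgeK; case: ltngtP => [_|_|/val_inj/enum_rank_inj/eqP].
  - by rewrite addr0.
  - by rewrite add0r.
  by rewrite eq_sym (negbTE (edge_neq _ _)).
case: (pickP (fun ab => ~~ on T ab.1 && joins (toggle T ab.1) ab.2)); last first.
  move=> no; have [w [ww _]] := balance_vertices tT we0.
  by exists w; split=> // a b aT jb; have := no (a, b); rewrite /= aT jb.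
case=> a b /= /andP[aT jb]; have /andP[bTa sab] := jb.
have [bT ba bea] := off_toggleK aT bTa.
have shift w1 u v k : (forall h, w1 h + w1 (e h) = d%:Z - 2 :> int) ->
  ~~ on T v -> v != u -> v != e u -> ~~ same (toggle T u) v (e v) ->
  exists w2, [/\ forall h, w2 h + w2 (e h) = d%:Z - 2 :> int,
    forall h, h != v -> h != e v -> w2 h = w1 h & turning w2 (toggle T u) u = k].
  move=> we1 vT vu veu sv; set S := toggle T u in sv *.
  have vS : ~~ on S v by apply: off_toggle.
  have one : same S u (e v) = ~~ same S u v.
    apply/idP/idP => [uev|uv].
      by apply: contra sv => uv; rewrite -(same_l uv).
    have := tree_add u v tT; rewrite (negbTE uv) /= => euv.
    have /orP[//|euev] := tree_add u (e v) tT.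
    by case/negP: sv; rewrite -(same_l euv).
  pose k1 := turning w1 S u.
  (* The sign depends on which of v and e v is the dart on the contour of u. *)
  pose c : int := if same S u v then k - k1 else k1 - k.
  exists (fun h => w1 h + ((if h == v then c else 0) - (if h == e v then c else 0))).
  split=> [h|h /negbTE -> /negbTE ->|]; last 2 first.
  - by rewrite subrr addr0.
  - have -> : turning (fun h => w1 h + ((if h == v then c else 0) -
        (if h == e v then c else 0))) S u = k1 + \sum_(h <- contour S u)
        ((if h == v then c else 0) - (if h == e v then c else 0)).
      rewrite -big_split; apply: eq_bigr => h _ /=; rewrite /dart_cost.
      case: ifP => // hS.
      have hv : h != v by apply: contraTneq hS => ->; rewrite (negbTE vS).
      have hev : h != e v by apply: contraTneq hS => ->; rewrite onE (negbTE vS).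
      by rewrite (negbTE hv) (negbTE hev) subrr addr0.
    rewrite big_uniq ?orbit_uniq // sumrB.
    rewrite (sum_indicator (fun=> c)) (sum_indicator (fun=> c)) /=.
    rewrite !mem_contour one /c; case: (same S u v) => /=; clear; lia.
  rewrite addrACA we1 (edge_eqC M h v) (edge_eqC M h (e v)) edgeK.
  by case: (h == v); case: (h == e v); clear; lia.
have [w1 [we1 _ k1]] := shift w0 a b 0 we0 bT ba bea sab.
have sba : ~~ same (toggle T b) a (e a) by rewrite -/(cross T b a) crossC.
have [ab aeb] : a != b /\ a != e b by rewrite eq_sym ba eq_sym edge_eqC bea.
have [w2 [we2 w21 k2]] := shift w1 b a 0 we1 aT ab aeb sba.
have [w [ww ww2]] := balance_vertices tT we2.
exists w; split=> //; apply: (vanishing_base euler ang ww tT aT jb).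
  apply: (tree_add_zero euler ww tT aT (z := a)); rewrite -k1; apply: turning_ext.
  by move=> h /(off_toggleK aT)[hT ha hea]; rewrite ww2 // w21.
apply: (tree_add_zero euler ww tT bT (z := b)); rewrite -k2; apply: turning_ext.
by move=> h /(off_toggleK bT)[hT hb heb]; rewrite ww2.
Qed.
End Weights.

(** * Short null-homotopic walks have backtracks *)

Section Cover.
Variables (D : eqType) (M : cmap D) (x0 : D).
Notation e := (edge M).
Notation U := (universal_cover M x0).

Definition backtrack_free (u : seq D) := forall s1 y s2, u <> s1 ++ y :: e y :: s2.

Definition cover_dart_of p (h : `[< is_cover_dart M x0 p >]) : cover_dart M x0 :=
  exist (fun p => is_true `[< is_cover_dart M x0 p >]) p h.

Lemma cover_vertex_class (p q : cover_dart M x0) :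
  same_vertex U p q -> (val p).1 = (val q).1.
Proof.
move=> /asboolP; elim=> {p q} [p q /= <-|p|p q _ ->|p q r _ -> _ ->] //.
Qed.

Lemma cover_vertex_lift (p q : cover_dart M x0) :
  (val p).1 = (val q).1 -> same_vertex M (val p).2 (val q).2 -> same_vertex U p q.
Proof.
move=> pq /asboolP h; apply/asboolP.
suff main a b : clos_refl_sym_trans D (fun a b => next M a = b) a b ->
    forall p q : cover_dart M x0, (val p).1 = (val q).1 -> (val p).2 = a ->
    (val q).2 = b -> clos_refl_sym_trans _ (fun a b => next U a = b) p q.
  exact: main h p q pq erefl erefl.
elim=> {a b h p q pq} [a b ab|a|a b _ IH|a b c ab IH1 bc IH2] p q pq pa qb.
- apply: rst_step; apply: val_inj.
  by rewrite /= /cover_next_pair pq pa ab -qb -surjective_pairing.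
- suff -> : p = q by apply: rst_refl.
  apply: val_inj; rewrite [LHS]surjective_pairing pq pa -qb.
  by rewrite -surjective_pairing.
- by apply: rst_sym; apply: IH.
have rP : `[< is_cover_dart M x0 ((val p).1, b) >].
  have /asboolP[u [wu up uc]] := valP p; apply/asboolP; exists u; split=> //.
  by apply: same_vertex_trans up _; rewrite pa; apply/asboolP.
pose r : cover_dart M x0 := cover_dart_of rP.
apply: (rst_trans _ _ _ r); first exact: IH1.
exact: IH2.
Qed.

Lemma homotopy_class_eq u v : homotopic M x0 u v ->
  homotopy_class M x0 u = homotopy_class M x0 v.
Proof.
move=> uv; apply/seteqP; split=> t /=; apply: rst_trans => //; exact: rst_sym.
Qed.

Lemma homotopy_class_inj u v : homotopy_class M x0 u = homotopy_class M x0 v ->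
  homotopic M x0 u v.
Proof.
move=> uv; suff : homotopy_class M x0 u v by [].
by rewrite uv; apply: rst_refl.
Qed.

Variables (x : D) (s u : seq D).
Hypothesis ws : walk M x0 s.
Hypothesis es : same_vertex M (walk_end M x0 s) x.
Hypothesis wu : walk M x u.
Hypothesis hu : homotopic M x u [::].
Hypothesis bu : backtrack_free u.
Let n := size u.
Let V k := homotopy_class M x0 (s ++ take k u).
Let y k := nth x u k.

Let w_take k : walk M x0 (s ++ take k u).
Proof.
rewrite walk_cat ws /= (walk_vertex _ es).
by move: wu; rewrite -{1}(cat_take_drop k u) walk_cat => /andP[].
Qed.

Let take_next k : k < n -> take k.+1 u = rcons (take k u) (y k).
Proof. by move=> kn; rewrite (take_nth x). Qed.

Let end_take k : k < n -> same_vertex M (walk_end M x0 (s ++ take k u)) (y k).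
Proof.
move=> kn; have := w_take k.+1; rewrite take_next // -rcons_cat walk_rcons.
by case/andP.
Qed.

Let liftP k : k < n -> `[< is_cover_dart M x0 (V k, y k) >].
Proof.
by move=> kn; apply/asboolP; exists (s ++ take k u); split=> //; apply: end_take.
Qed.

(** The closed walk u lifts to a closed walk in the universal cover, whose
    vertices are the classes V k of its prefixes. A shortest stretch of u
    between two equal classes lifts to a closed walk without repeated
    vertices, and an edge used in both directions would be used by two
    consecutive darts, a backtrack of u. *)
Lemma short_cover_cycle : 0 < n -> exists2 c : seq (cover_dart M x0),
  is_cycle U c & size c <= n.
Proof.
move=> n0; pose p0 : cover_dart M x0 := cover_dart_of (liftP n0).
pose lift k := insubd p0 (V k, y k).
have liftE k : k < n -> val (lift k) = (V k, y k).
  by move=> kn; rewrite /lift insubdK //; apply: liftP.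
have edge_class k : k < n -> (val (cover_edge (lift k))).1 = V k.+1.
  move=> kn; have -> : (val (cover_edge (lift k))).1 =
    (cover_edge_pair M x0 (val (lift k))).1 by [].
  rewrite liftE // cover_edge_class; by rewrite rcons_cat -take_next.
have Vn : V 0 = V n.
  rewrite /V take0 cats0 /n take_size; apply: homotopy_class_eq; apply: rst_sym.
  have := @homotopy_ctx_at _ M x0 x s u [::] [::] es hu; rewrite !cats0; apply.
  by have := w_take n; rewrite /n take_size.
pose P m := [exists i : 'I_n.+1, [&& i + m <= n, 0 < m & `[< V i = V (i + m) >]]].
have exP : exists m, P m.
  exists n; apply/existsP; exists ord0; rewrite add0n leqnn n0 /=.
  exact/asboolP.
case: (ex_minnP exP) => m /existsP[i /and3P[imn m0 /asboolP Vim]] minm.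
have inj k l : i <= k -> k < l -> l < i + m -> V k <> V l.
  move=> ik kl lim Vkl; have kn : k < n.+1 by lia.
  suff /minm : P (l - k) by lia.
  apply/existsP; exists (Ordinal kn); rewrite /= subnKC ?subn_gt0 ?kl ?(ltnW kl) //.
  by apply/and3P; split=> //; [lia|apply/asboolP].
have consec k : i <= k < i + m -> k.+1 < n -> consecutive U (lift k) (lift k.+1).
  move=> ik kn; apply: cover_vertex_lift.
    by rewrite [LHS]edge_class ?liftE //; lia.
  have kn' : k < n by lia.
  rewrite /= !liftE //=.
  have := end_take kn; rewrite take_next // -rcons_cat walk_end_rcons.
  by [].
have close : consecutive U (lift (i + m).-1) (lift i).
  have kn : (i + m).-1 < n by lia.
  have iN : i < n by lia.
  apply: cover_vertex_lift.
    by rewrite [LHS]edge_class ?liftE //= Vim; congr V; lia.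
  rewrite /= !liftE //=.
  have := homotopy_class_inj Vim => /homotopic_walk /(_ (w_take i)) [_].
  have -> : i + m = ((i + m).-1).+1 by lia.
  rewrite take_next // -rcons_cat walk_end_rcons -/(y _) /= => h.
  by apply: same_vertex_trans (end_take iN); rewrite same_vertex_sym.
pose c := lift i :: map lift (iota i.+1 m.-1).
have cE : c = map lift (iota i m) by rewrite /c; case: (m) m0.
have nth_c k : k < m -> nth p0 c k = lift (i + k).
  by move=> km; rewrite cE (nth_map 0) ?size_iota // nth_iota.
have size_c : size c = m by rewrite cE size_map size_iota.
have edge_lift k l : i <= k < i + m -> i <= l < i + m ->
    cover_edge (lift k) = lift l -> k.+1 < i + m -> False.
  move=> ik il kl kim; have kn : k < n by lia. have ln : l < n by lia.
  have lk : l = k.+1.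
    have VV : V k.+1 = V l by rewrite -(edge_class k kn) kl liftE.
    have ikl : i <= l /\ i <= k.+1 by lia.
    have [lk|kl'|//] := ltngtP l k.+1.
      by case: (inj l k.+1 ikl.1 lk kim).
    by case: (inj k.+1 l ikl.2 kl') => //; lia.
  have ey : e (y k) = y k.+1.
    by have := congr1 (fun p => (val p).2) kl; rewrite /= !liftE //= lk.
  apply: (@bu (take k u) (y k) (drop k.+2 u)).
  have k1n : k.+1 < n by lia.
  by rewrite ey /y -drop_nth // -drop_nth // cat_take_drop.
have noedge k l : i <= k < i + m -> i <= l < i + m ->
    cover_edge (lift k) <> lift l.
  move=> ik il kl; have [kim|kim] := ltnP k.+1 (i + m).
    exact: edge_lift ik il kl kim.
  have lk : cover_edge (lift l) = lift k by rewrite -kl cover_edgeK.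
  have [lim|lim] := ltnP l.+1 (i + m).
    exact: edge_lift il ik lk lim.
  have kE : k = l by lia.
  by have := cover_edge_neq (lift k); rewrite kl kE eqxx.
exists c; last by rewrite size_c; lia.
apply/and4P; split=> //.
- have step : forall j k, i <= k -> k + j < i + m ->
      path (consecutive U) (lift k) (map lift (iota k.+1 j)) /\
      last (lift k) (map lift (iota k.+1 j)) = lift (k + j).
    elim=> [|j IHj] k ik kj; first by rewrite addn0.
    have [|| p1 p2] := IHj k.+1; [lia|lia|].
    rewrite /= consec ?p1 ?p2 ?addSnnS //; lia.
  have [|| p1 p2] := step m.-1 i; [lia|lia|].
  rewrite /c /= rcons_path p1 p2.
  by have -> : i + m.-1 = (i + m).-1 by lia.
- apply/allP=> p; rewrite cE => /mapP[k]; rewrite mem_iota => ik ->.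
  apply/negP => /mapP[l]; rewrite mem_iota => il; exact: noedge.
- apply/(pairwiseP p0) => k l; rewrite !inE size_c => km lm kl.
  rewrite !nth_c //; apply/negP => /cover_vertex_class.
  have kn : i + k < n by lia. have ln : i + l < n by lia.
  rewrite !liftE //=; apply: inj; lia.
Qed.
End Cover.

Section Girth.
Variables (D : finType) (M : cmap D).
Notation N := (next M).
Notation e := (edge M).
Implicit Types S T : edge_set M.
Hypothesis connected :
  forall x y : D, connect [rel a b | (b == e a) || (b == N a)] x y.
Variables (d : nat) (w : D -> int) (x0 : D).
Local Open Scope ring_scope.
Hypothesis ww : weighting M d w.
Hypothesis girth : forall c, is_cycle (universal_cover M x0) c -> (d <= size c)%N.
Local Notation tau := (turning w).

Lemma connected_walk a b : exists2 s, walk M a s & same_vertex M (walk_end M a s) b.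
Proof.
have /connectP[p + ->] := connected a b; elim: p a => [|k p IH] a /=.
  by exists [::]; rewrite ?walk_end_nil ?same_vertex_refl.
case/andP=> ak /IH[s ws es].
case/orP: ak => /eqP kE.
  by exists (a :: s); rewrite ?walk_cons ?walk_end_cons -?kE ?same_vertex_refl.
have ka : same_vertex M k a by rewrite kE same_vertex_sym same_vertex_next.
exists s; first by rewrite -(walk_vertex _ ka).
apply: same_vertex_trans es; apply: walk_end_vertex; by rewrite same_vertex_sym.
Qed.

Lemma short_backtrack x u : walk M x u -> homotopic M x u [::] ->
  u != [::] -> (size u < d)%N -> exists s1 y s2, u = s1 ++ y :: e y :: s2.
Proof.
move=> wu hu u0 ltd; apply: contrapT => no.
have bu : backtrack_free M u.
  by move=> s1 y s2 uE; apply: no; exists s1, y, s2.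
have [s ws es] := connected_walk x0 x.
have [|c cyc le] := @short_cover_cycle D M x0 x s u ws es wu hu bu.
  by case: (u) u0.
by have := girth cyc; rewrite leqNgt (leq_ltn_trans le ltd).
Qed.

Lemma word_decompose S L s1 y s2 : word S L = s1 ++ y :: s2 ->
  exists A B, [/\ L = A ++ y :: B, word S A = s1, on S y & word S B = s2].
Proof.
elim: L s1 => [|h L IH] s1 /=; first by case: s1.
case: ifP => hS; last first.
  by case/IH=> A [B [-> <- yS <-]]; exists (h :: A), B; rewrite /= hS.
case: s1 => [[<- <-]|a s1 [<- /IH[A [B [-> <- yS <-]]]]].
  by exists [::], L.
by exists (h :: A), B; rewrite /= hS.
Qed.

(** The contour has a backtrack y, e y in its word, that is, a spur ending in
    a vertex where S has no other edge. Removing the edge of the spur isolates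
    this vertex, and by absorb neither the turning nor null-homotopy is
    affected. When no dart is left, the contour is that of a vertex. *)
Lemma short_contour S z : null_contour S z -> (size (word S (contour S z)) < d)%N ->
  tau S z = d%:Z.
Proof.
have [n] := ubnP (size (word S (contour S z))); elim: n S z => // n IH S z lt cz ltd.
have [wz _] := contour_walk S z.
have [w0|w0] := eqVneq (word S (contour S z)) [::].
  have [-> _] // : treelike d w S z.
  apply: (treelike_vertex ww) => u; rewrite -mem_contour => uz.
  apply/negP=> uS; have : u \in word S (contour S z) by rewrite mem_filter uS.
  by rewrite w0.
have [s1 [y [s2 wE]]] := short_backtrack wz cz w0 ltd.
have [A [B [cE wA yS]]] := word_decompose wE.
rewrite -[e y :: s2]cat0s => /word_decompose[C [E [BE wC _ wE2]]].
have cS : is_contour S (A ++ y :: C ++ e y :: E) by rewrite -BE -cE is_contour_contour.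
have [c1 c2] := is_contour_split_at cS.
set S' := toggle S y in c1 c2.
have zy : same S z y by rewrite -mem_contour cE mem_cat mem_head orbT.
have yS' : ~~ on S' y by rewrite toggle_self yS.
have : is_contour S (y :: C ++ e y :: E ++ A).
  by move: cS; rewrite is_contour_shift /= -catA.
case/andP=> /= /andP[]; rewrite mem_cat negb_or inE => /andP[uy /norP[_ yEA]].
rewrite cat_uniq /= => /and3P[_ _ /andP[eyEA _]] _.
have pl : treelike d w S' (e y).
  apply: (treelike_vertex ww) => u; rewrite (is_contour_same _ c2) ?mem_head //.
  rewrite inE => /orP[/eqP->|uC]; first by rewrite onE.
  rewrite on_toggle; have -> : on S u = false.
    apply/negP=> uS; have : u \in word S C by rewrite mem_filter uS.
    by rewrite wC.
  case/andP: c2 => /andP[eyC _] _.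
  have uney : u != e y by apply: contraNneq eyC => <-.
  have uny : u != y by apply: contraNneq uy => <-.
  by rewrite (negbTE uny) (negbTE uney).
have yC : y \notin e y :: C by rewrite inE eq_sym (negbTE (edge_neq _ _)).
have ns : ~~ same S' (e y) y by rewrite (is_contour_same _ c2) ?mem_head.
have ns' : ~~ same S' (e y) (e (e y)) by rewrite edgeK.
have k' : tau S' (e y) = if on S' (e y) then - d%:Z else d%:Z.
  by rewrite onE (negbTE yS') pl.1.
have [ky cy] := absorb ww ns' ns k' pl.2.
have SE : toggle S' (e y) = S by rewrite toggle_edge toggleK.
rewrite SE in ky cy.
have wS' : (size (word S (contour S z)) = (size (word S' (contour S' y))).+2)%N.
  rewrite (contour_cons c1) /= (negbTE yS') wE -wA -wE2 word_toggle //.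
  by rewrite word_cat !size_cat /= !addnS addnC.
rewrite wS' in lt ltd; rewrite (turning_same w zy) ky; apply: IH.
- exact: ltnW lt.
- by apply/cy/(null_contour_same zy).
exact: ltnW (ltnW ltd).
Qed.
End Girth.

(** * Making the weights nonnegative *)

Section Potential.
Variables (D : finType) (M : cmap D).
Notation N := (next M).
Notation e := (edge M).
Notation F := (face M).
Implicit Types S T : edge_set M.
Hypothesis connected :
  forall x y : D, connect [rel a b | (b == e a) || (b == N a)] x y.
Variables (d : nat) (x0 : D).
Local Open Scope ring_scope.
Hypothesis girth : forall c, is_cycle (universal_cover M x0) c -> (d <= size c)%N.

(** What is left of the vanishing of turnings once the trees are forgotten: it
    depends on w through turnings only, hence is invariant under coboundaries. *)
Definition nonneg_or_disc w := forall S h,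
  (forall y, on S y -> same S h y || same S h (e y)) ->
  0 <= turning w S h \/ disc d w S h.

Lemma sum_contour S x (f : D -> int) :
  \sum_(h <- contour S x) f h = \sum_(h | same S x h) f h.
Proof.
rewrite big_uniq ?orbit_uniq //; apply: eq_bigl => y.
exact: mem_contour.
Qed.

(** As q is constant on faces, the sum telescopes along the contour: nothing
    happens when a dart on S is followed, and turning past h leads from the
    face of h to the face of e h. *)
Lemma sum_coboundary S x (q : D -> int) : (forall h, q (F h) = q h) ->
  \sum_(h <- contour S x) (if on S h then 0 else q h - q (e h)) = 0.
Proof.
move=> qF; rewrite (eq_bigr (fun h => q h - q (contour_next S h))).
  rewrite sum_contour sumrB (reindex_inj (@contour_next_inj _ M S)) /=.
  apply/eqP; rewrite subr_eq0; apply/eqP; apply: eq_bigl => h.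
  by rewrite -(same_r _ (same_next S h)).
move=> h _; case: (boolP (on S h)) => hS.
  by rewrite contour_next_on // qF subrr.
by rewrite contour_next_off // -[h in N h](edgeK M) -/(face M (e h)) qF.
Qed.

Definition cobound (w q : D -> int) h := w h + (q h - q (e h)).

Lemma turning_cobound w q S x : (forall h, q (F h) = q h) ->
  turning (cobound w q) S x = turning w S x.
Proof.
move=> qF; rewrite -[RHS]addr0 -(sum_coboundary S x qF) -big_split /=.
apply: eq_bigr => h _; rewrite /dart_cost.
by case: (on S h); rewrite ?addr0.
Qed.

Lemma turning_no_edge w z : turning w (no_edge M) z = \sum_(y <- orbit N z) w y.
Proof.
rewrite /turning (@orbit_contour _ _ _ _ N); last by move=> y _; rewrite contour_next_off ?on0.
by apply: eq_bigr => y _; rewrite /dart_cost on0.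
Qed.

Lemma weighting_cobound w q : (forall h, q (F h) = q h) ->
  weighting M d w -> weighting M d (cobound w q).
Proof.
move=> qF [we wv]; split=> [h|z].
  by rewrite /cobound edgeK addrACA we; clear; lia.
by rewrite -turning_no_edge turning_cobound // turning_no_edge.
Qed.

Lemma nonneg_or_disc_cobound w q : (forall h, q (F h) = q h) ->
  nonneg_or_disc w -> nonneg_or_disc (cobound w q).
Proof. by move=> qF tw S h mi; rewrite /disc turning_cobound //; apply: tw. Qed.

(** The edge set is that of the darts at which X goes along the face. X cannot
    traverse such an edge in one direction and turn past its other dart, as
    both steps lead to the same dart. *)
Lemma simple_cycle_contour (X : seq D) : uniq X ->
  (forall h, h \in X -> path.next X h = F h \/ path.next X h = N h) ->
  exists S, [/\ is_contour S X, forall y, on S y -> y \in X \/ e y \in X &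
    forall h, h \in X -> on S h = (path.next X h == F h)].
Proof.
move=> uX nX; pose A := [set h | (h \in X) && (path.next X h == F h)].
have cl : edge_closed M [set h | (h \in A) || (e h \in A)].
  by apply/forallP=> h; rewrite !inE edgeK orbC.
pose S : edge_set M := Sub _ cl.
have onA h : on S h = (h \in A) || (e h \in A) by rewrite /on /= inE.
have onX h : h \in X -> on S h = (path.next X h == F h).
  move=> hX; rewrite onA inE hX /=; case: eqP => //= nF.
  rewrite inE; apply/negP=> /andP[ehX /eqP ne].
  have nh : path.next X h = N h by case: (nX h hX).
  have : path.prev X (path.next X (e h)) = path.prev X (path.next X h).
    by rewrite ne nh /face edgeK.
  by rewrite !prev_next // => /eqP; rewrite (negbTE (edge_neq _ _)).
exists S; split=> //.
  rewrite /is_contour uX; apply: (sub_in_cycle (P := mem X)) (cycle_next uX).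
    move=> a b aX _ /eqP <-; apply/eqP; rewrite /contour_next onX //.
    case: eqP => [-> //|nF]; by case: (nX a aX).
  exact/allP.
by move=> y; rewrite onA !inE => /orP[]/andP[? _]; [left|right].
Qed.

(** A followed dart costs -1, a passed one at most 0, and h0 at most -1. So
    the turning is below minus the number of darts followed. It must then be
    -d, and fewer than d darts are followed, which by short_contour makes the
    turning d. *)
Lemma no_negative_cycle w h0 (X : seq D) : weighting M d w -> nonneg_or_disc w ->
  uniq X -> h0 \in X -> w h0 < 0 -> path.next X h0 = N h0 ->
  (forall h, h \in X -> path.next X h = F h \/ path.next X h = N h /\ w h <= 0) ->
  False.
Proof.
move=> ww tw uX h0X w0 nh0 nX.
have [|S [cX mi onX]] := simple_cycle_contour uX.
  by move=> h /nX[|[]]; auto.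
have mX h : h \in X -> same S h0 h by rewrite (is_contour_same _ cX).
have kE := turning_list w cX h0X.
have szE : size (word S (contour S h0)) = count (on S) X.
  rewrite size_filter (contour_rot cX h0X).
  by have /seq.permP-> : perm_eq (rot (index h0 X) X) X by rewrite perm_rot.
have bound : turning w S h0 <= - (count (on S) X)%:Z - 1.
  have -> : - (count (on S) X)%:Z - 1 =
     \sum_(h <- X) (- (on S h)%:Z - (if h == h0 then 1 else 0)) :> int.
    rewrite sumrB sumrN; congr (- _ - _).
      by rewrite -sumn_count; elim: (X) => [|a l IH] /=; rewrite ?big_nil ?big_cons -?IH ?PoszD.
    by rewrite big_uniq // (sum_indicator (fun=> 1)) h0X.
  rewrite kE !big_seq; apply: ler_sum => h hX; rewrite /dart_cost onX //.
  have [hh0|hh0] := eqVneq h h0.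
    rewrite hh0 nh0; case: eqP => [/next_inj /eqP|_].
      by rewrite eq_sym (negbTE (edge_neq _ _)).
    by move: w0; clear; lia.
  case: eqP => [//|nF]; case: (nX h hX) => [//|[_]].
  by clear; lia.
have [|k0|[kd cd]] := tw S h0.
- by move=> y /mi[/mX ->|/mX ->]; rewrite ?orbT.
- by move: k0 bound; clear; lia.
have [lt|le] := ltnP (size (word S (contour S h0))) d.
  have kd' := short_contour connected ww girth cd lt.
  by move: kd kd' bound; clear; lia.
by move: le bound; rewrite szE kd; clear; lia.
Qed.

Definition negpart (x : int) : nat := if x < 0 then `|x|%N else 0%N.

Lemma negpart_le x y : y <= x -> (negpart x <= negpart y)%N.
Proof. by rewrite /negpart; case: (ltrP x 0); case: (ltrP y 0); lia. Qed.

Lemma negpart_ge0 x : 0 <= x -> negpart x = 0%N.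
Proof. by rewrite /negpart; case: ltrP. Qed.

Lemma negpart_succ x : x < 0 -> (negpart (x + 1) < negpart x)%N.
Proof. by rewrite /negpart; case: (ltrP x 0); case: (ltrP (x + 1) 0); lia. Qed.

(** By induction on the total negative part. Starting beyond a negative dart
    h0, let R be the set of faces that can be reached by crossing darts of
    weight at most 0. If R does not contain the face of h0, lowering the
    potential by 1 on R raises the weight of h0, and lowers only positive
    weights. Otherwise a shortest way back to h0 closes up to a path excluded
    by no_negative_cycle. *)
Lemma exists_nonneg w : weighting M d w -> nonneg_or_disc w ->
  exists w', [/\ weighting M d w', nonneg_or_disc w' & forall h, 0 <= w' h].
Proof.
have [n] := ubnP (\sum_h negpart (w h))%N; elim: n w => // n IH w lt ww tw.
case: (pickP (fun h => w h < 0)) => [h0 w0|nonneg]; last first.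
  by exists w; split=> // h; have := nonneg h; rewrite ltNge => /negbFE.
pose r := [rel a b | (b == F a) || (w a <= 0) && (b == N a)].
pose R : pred D := connect r (N h0).
have RF h : R h -> R (F h).
  by move=> Rh; apply: connect_trans Rh (connect1 _); rewrite /= eqxx.
have RFr h : R (F h) -> R h.
  move=> Rh; apply: connect_trans Rh _.
  have := fconnect1 F h; rewrite (fconnect_sym (@face_inj _ M)).
  by apply: connect_sub => a b /eqP <-; apply: connect1; rewrite /= eqxx.
have RFE h : R (F h) = R h by apply/idP/idP; [apply: RFr|apply: RF].
(* Turning past h is the same as crossing into the face of e h. *)
have Re h : R h -> w h <= 0 -> R (e h).
  move=> Rh wh; apply: RFr; rewrite /face edgeK.
  by apply: connect_trans Rh (connect1 _); rewrite /= wh eqxx orbT.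
have [Rh0|Rh0] := boolP (R h0).
  have /connectP[p pp] := Rh0; case/shortenP: pp => p' pp' up' _ pl.
  have cX : path.cycle r (N h0 :: p').
    by rewrite /= rcons_path pp' -pl /= (ltW w0) eqxx orbT.
  case: (@no_negative_cycle w h0 (N h0 :: p') ww tw up') => //.
  - by rewrite {1}pl mem_last.
  - have := cycle_next up'; rewrite /= rcons_path -pl => /andP[_ /eqP].
    by [].
  move=> h hX; have := next_cycle cX hX => /orP[/eqP|/andP[wh /eqP]]; auto.
pose q h : int := if R h then -1 else 0.
have qF h : q (F h) = q h by rewrite /q RFE.
apply: (IH (cobound w q)); last 2 first.
- exact: weighting_cobound.
- exact: nonneg_or_disc_cobound.
rewrite -ltnS; apply: leq_trans lt; rewrite ltnS.
have le h : (negpart (cobound w q h) <= negpart (w h))%N.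
  rewrite /cobound /q; case Rh: (R h); case Reh: (R (e h)) => /=.
  - by apply: negpart_le; clear; lia.
  - have wh : 0 < w h.
      by rewrite ltNge; apply/negP => /(Re h Rh); rewrite Reh.
    by rewrite negpart_ge0 //; move: wh; clear; lia.
  - by apply: negpart_le; clear; lia.
  - by apply: negpart_le; clear; lia.
rewrite (bigD1 h0) //= [ltnRHS](bigD1 h0) //= -addSn leq_add ?leq_sum //.
have Reh0 : R (e h0) by apply: RFr; rewrite /face edgeK; apply: connect0.
rewrite /cobound /q (negbTE Rh0) Reh0.
by have := negpart_succ w0; congr (negpart _ < _)%N; clear; lia.
Qed.

End Potential.

(** * The two sides of a cycle *)

Section Cycles.
Variables (D : finType) (M : cmap D).
Notation N := (next M).
Notation e := (edge M).
Notation F := (face M).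

Lemma same_vertexE x y : same_vertex M x y = fconnect N x y.
Proof.
apply/asboolP/idP => [h|/iter_findex <-]; last first.
  elim: (findex _ _ _) => [|m IH] /=; first exact: rst_refl.
  by apply: rst_trans IH _; apply: rst_step.
elim: h => {x y} [x y <-|x|x y _|x y z _ xy _ yz].
- exact: fconnect1.
- exact: connect0.
- by rewrite (fconnect_sym (@next_inj _ M)).
- exact: connect_trans xy yz.
Qed.

Lemma sector_split a b : same_vertex M a b -> a != b ->
  orbit N a = a :: sector M a b ++ b :: sector M b a.
Proof.
rewrite same_vertexE => ab nab; have [L La] : exists L, orbit N a = a :: L.
  by rewrite /orbit -orderSpred; eexists.
have /andP[uL cL] : uniq (orbit N a) && fcycle N (orbit N a).
  by rewrite orbit_uniq (cycle_orbit (@next_inj _ M)).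
have bL : b \in L.
  by move: ab; rewrite fconnect_orbit La inE eq_sym (negbTE nab).
case/splitPr: L / bL La => A B La.
have sec x K z E : orbit N x = x :: K ++ z :: E -> sector M x z = K.
  move=> xE; have zK : z \notin x :: K.
    have := orbit_uniq N x; rewrite xE -cat_cons cat_uniq => /and3P[_ /hasPn h _].
    by apply: h; rewrite mem_head.
  have ix : findex N x z = (size K).+1.
    by rewrite /findex xE -cat_cons index_cat (negbTE zK) /= eqxx addn0.
  rewrite /sector ix -(@take_traject _ N (fingraph.order N x)).
    by rewrite -/(orbit N x) xE /= take_size_cat.
  by rewrite -size_orbit xE /= size_cat /=; clear; lia.
have bE : orbit N b = b :: B ++ a :: A.
  have bin : b \in orbit N a by rewrite La inE mem_cat mem_head !orbT.
  rewrite (orbitE cL uL bin) La -cat_cons.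
  have bA : b \notin a :: A.
    move: uL; rewrite La -cat_cons cat_uniq => /and3P[_ /hasPn h _].
    by apply: h; rewrite mem_head.
  by rewrite index_cat (negbTE bA) /= eqxx addn0 -[(size A).+1]/(size (a :: A)) rot_size_cat.
by rewrite (sec _ _ _ _ La) (sec _ _ _ _ bE).
Qed.

Section OneCycle.
Variable c : seq D.
Hypothesis cyc : is_cycle M c.

Lemma cycle_uniq : uniq c.
Proof.
have /and4P[_ _ _ pc] := cyc; rewrite uniq_pairwise; apply: sub_pairwise pc.
by move=> x y /=; apply: contraNneq => ->; apply: same_vertex_refl.
Qed.

Lemma cycle_vertex_inj x y : x \in c -> y \in c -> same_vertex M x y -> x = y.
Proof.
have /and4P[_ _ _ /(pairwiseP x) pc] := cyc.
move=> xc yc xy; have ltx := xc; have lty := yc; rewrite -!index_mem in ltx lty.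
rewrite -(nth_index x xc) -(nth_index x yc).
have [lt|lt|->//] := ltngtP (index x c) (index y c).
  by have := pc _ _ ltx lty lt; rewrite !nth_index // xy.
by have := pc _ _ lty ltx lt; rewrite !nth_index // same_vertex_sym xy.
Qed.

Lemma cycle_enter x : x \in c -> same_vertex M (e (prev c x)) x.
Proof. by move=> xc; have /and4P[_ cc _ _] := cyc; apply: prev_cycle cc xc. Qed.

Lemma cycle_edge x : x \in c -> e x \notin c.
Proof. by have /and4P[_ _ /allP h _] := cyc; apply: h. Qed.

Lemma cycle_enter_neq x : x \in c -> e (prev c x) != x.
Proof.
move=> xc; apply/eqP => ex; have := @cycle_edge (prev c x).
by rewrite ex mem_prev xc => /(_ isT).
Qed.

Lemma cycle_edges_closed : edge_closed M [set h | (h \in c) || (e h \in c)].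
Proof. by apply/forallP=> h; rewrite !inE edgeK orbC. Qed.

Definition cycle_edges : edge_set M := Sub _ cycle_edges_closed.
Let S := cycle_edges.

Lemma on_cycle_edges h : on S h = (h \in c) || (e h \in c).
Proof. by rewrite /on /= inE. Qed.

(** A cycle visits each vertex once, so it occupies only the two darts there
    that gamma_R and gamma_L treat as on the cycle. *)
Lemma on_cycle_at x h : x \in c -> on S h -> same_vertex M x h ->
  h = x \/ h = e (prev c x).
Proof.
move=> xc; rewrite on_cycle_edges => /orP[hc|ehc] xh.
  by left; apply: cycle_vertex_inj; rewrite // same_vertex_sym.
right; rewrite -[h](edgeK M); congr (e _).
have := cycle_enter (_ : path.next c (e h) \in c).
rewrite mem_next ehc prev_next ?cycle_uniq // edgeK => /(_ isT) hn.
have <- : path.next c (e h) = x; last by rewrite prev_next ?cycle_uniq.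
apply: cycle_vertex_inj; rewrite ?mem_next //.
by rewrite same_vertex_sym; apply: same_vertex_trans xh hn.
Qed.

(** What the contour on the right side does at the vertex of x, entered
    through x': it turns past the darts of the sector, and then follows x. *)
Definition corner_seq x' x := rcons (sector M (e x') x) x.

Lemma sector_vertex a b y : same_vertex M a b -> a != b -> y \in sector M a b ->
  [/\ same_vertex M a y, y != a & y != b].
Proof.
move=> ab nab yab; have aE := sector_split ab nab; split.
- by rewrite same_vertexE fconnect_orbit aE inE mem_cat yab orbT.
- have := orbit_uniq N a; rewrite aE /= mem_cat negb_or -andbA => /andP[+ _].
  by apply: contraNneq => {1}<-.
have := orbit_uniq N a; rewrite aE /= cat_uniq /= => /and4P[_ _ /norP[+ _] _].
by apply: contraNneq => {1}<-.
Qed.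

Lemma sector_off x y : x \in c -> y \in sector M (e (prev c x)) x -> ~~ on S y.
Proof.
move=> xc /(sector_vertex (cycle_enter xc) (cycle_enter_neq xc))[xy ny nyx].
apply/negP=> /(on_cycle_at xc)[|yx|yx].
- by apply: same_vertex_trans xy; rewrite same_vertex_sym cycle_enter.
- by rewrite yx eqxx in nyx.
- by rewrite yx eqxx in ny.
Qed.

Lemma corner_seq_path x : x \in c ->
  fpath (contour_next S) (prev c x) (corner_seq (prev c x) x).
Proof.
move=> xc; have en := cycle_enter xc; have nen := cycle_enter_neq xc.
have := cycle_orbit (@next_inj _ M) (e (prev c x)).
rewrite (sector_split en nen) /= rcons_cat cat_path /= => /and3P[p1 p2 _].
have off y : y \in sector M (e (prev c x)) x -> contour_next S y = N y.
  by move=> /(sector_off xc); apply: contour_next_off.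
have on_p : contour_next S (prev c x) = N (e (prev c x)).
  by rewrite contour_next_on // on_cycle_edges mem_prev xc.
have main l b z : fpath N b (rcons l z) -> {in l, forall y, contour_next S y = N y} ->
    contour_next S (prev c x) = N b -> fpath (contour_next S) (prev c x) (rcons l z).
  case: l => [|a l] /=; first by move=> /andP[/eqP<- _] _ ->; rewrite eqxx.
  case/andP=> /eqP<- pl offl ->; rewrite eqxx /=.
  move: (N b) pl offl => {}a; elim: l a => [|k l IH] a /=.
    by move=> /andP[/eqP<- _] offl; rewrite offl ?mem_head ?eqxx.
  case/andP=> /eqP <- pl offl; rewrite offl ?mem_head // eqxx /=.
  by apply: IH => // y yl; apply: offl; rewrite inE yl orbT.
by apply: (main _ (e (prev c x))) => //; rewrite rcons_path p1.
Qed.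

Definition right_contour := flatten [seq corner_seq (prev c x) x | x <- c].

Lemma right_contour_path : fcycle (contour_next S) right_contour.
Proof.
have main s x' : path (fun a b => a == prev c b) x' s -> {subset s <= c} ->
    fpath (contour_next S) x' (flatten [seq corner_seq (prev c x) x | x <- s]) /\
    last x' (flatten [seq corner_seq (prev c x) x | x <- s]) = last x' s.
  elim: s x' => [|x s IH] x' //= /andP[/eqP -> ps] sub.
  have xc : x \in c by apply: sub; rewrite mem_head.
  rewrite cat_path corner_seq_path //= last_cat last_rcons.
  by apply: IH => // y ys; apply: sub; rewrite inE ys orbT.
have z : D by have /and4P[+ _ _ _] := cyc; case: (c).
have lastE (s : seq D) x y : s != [::] -> last x s = last y s by case: s.
have nc : c != [::] by case/and4P: cyc.
have nr : right_contour != [::].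
  have ne (s : seq D) : s != [::] ->
      flatten [seq corner_seq (prev c x) x | x <- s] != [::].
    by case: s => // x s _ /=; rewrite /corner_seq -cats1 -catA; case: (sector _ _ _).
  exact: ne.
have := cycle_prev cycle_uniq; rewrite (cycle_path z) => /main[//|p1 p2].
rewrite (cycle_path z) (lastE _ z (last z c) nr) p2.
by rewrite (lastE c _ z nc).
Qed.

Lemma corner_seq_vertex x h : x \in c -> h \in corner_seq (prev c x) x ->
  same_vertex M x h.
Proof.
move=> xc; rewrite mem_rcons inE => /orP[/eqP->|]; first exact: same_vertex_refl.
case/(sector_vertex (cycle_enter xc) (cycle_enter_neq xc)) => xh _ _.
by apply: same_vertex_trans xh; rewrite same_vertex_sym cycle_enter.
Qed.

Lemma corner_seq_uniq x : x \in c -> uniq (corner_seq (prev c x) x).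
Proof.
move=> xc; have en := cycle_enter xc; have nen := cycle_enter_neq xc.
have := orbit_uniq N (e (prev c x)); rewrite (sector_split en nen) /=.
rewrite -cat_rcons cat_uniq => /andP[_ /and3P[+ _ _]].
by [].
Qed.

Lemma right_contourP : is_contour S right_contour.
Proof.
rewrite /is_contour right_contour_path andbT /right_contour.
have /and4P[_ _ _ pc] := cyc.
suff main s : {subset s <= c} -> pairwise (fun x y => ~~ same_vertex M x y) s ->
    uniq (flatten [seq corner_seq (prev c x) x | x <- s]) by apply: main pc.
elim: s => //= x s IH sub /andP[/allP xs ps].
have xc : x \in c by apply: sub; rewrite mem_head.
have sc y : y \in s -> y \in c by move=> ys; apply: sub; rewrite inE ys orbT.
rewrite cat_uniq corner_seq_uniq // IH // andbT; apply/hasPn => h.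
case/flattenP=> l /mapP[y ys ->] hy; apply/negP=> hx.
have := xs y ys; rewrite (same_vertex_trans (corner_seq_vertex xc hx)) //.
by rewrite same_vertex_sym corner_seq_vertex ?sc.
Qed.

Lemma right_contour_word : word S right_contour = c.
Proof.
suff main s : {subset s <= c} ->
    word S (flatten [seq corner_seq (prev c x) x | x <- s]) = s by apply: main.
elim: s => //= x s IH sub.
have xc : x \in c by apply: sub; rewrite mem_head.
rewrite word_cat IH; last by move=> y ys; apply: sub; rewrite inE ys orbT.
rewrite /corner_seq -cats1 word_cat /= on_cycle_edges xc /=.
suff -> : word S (sector M (e (prev c x)) x) = [::] by [].
apply/eqP; rewrite -[_ == _]negbK -has_filter; apply/hasPn => y.
exact: sector_off.
Qed.

Local Open Scope ring_scope.

Lemma right_contour_turning (w : D -> nat) h : h \in right_contour ->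
  turning (fun x => (w x)%:Z) S h = (gamma_R M w c)%:Z - (size c)%:Z.
Proof.
move=> hr; rewrite (turning_list _ right_contourP hr) /right_contour /gamma_R.
suff main s : {subset s <= c} ->
    \sum_(h <- flatten [seq corner_seq (prev c x) x | x <- s])
      dart_cost (fun x => (w x)%:Z) S h =
    (\sum_(x <- s) \sum_(y <- sector M (e (prev c x)) x) w y)%N%:Z - (size s)%:Z.
  exact: main.
elim: s => [|x s IH] sub; first by rewrite /= !big_nil.
have xc : x \in c by apply: sub; rewrite mem_head.
rewrite /= big_cat /= IH; last by move=> y ys; apply: sub; rewrite inE ys orbT.
rewrite big_cons PoszD /corner_seq big_rcons /=.
have -> : dart_cost (fun x => (w x)%:Z) S x = -1 by rewrite /dart_cost on_cycle_edges xc.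
have -> : \sum_(y <- sector M (e (prev c x)) x) dart_cost (fun x => (w x)%:Z) S y =
    (\sum_(y <- sector M (e (prev c x)) x) w y)%N%:Z.
  rewrite -[RHS]natz natr_sum !big_seq; apply: eq_bigr => y ys.
  by rewrite /dart_cost (negbTE (sector_off xc ys)) natz.
by clear; lia.
Qed.

Lemma right_contour_min y : on S y ->
  forall h, h \in right_contour -> same S h y || same S h (e y).
Proof.
move=> yS h hr; have inr x : x \in c -> same S h x.
  rewrite (is_contour_same _ right_contourP hr) -right_contour_word mem_filter.
  by case/andP.
by move: yS; rewrite on_cycle_edges => /orP[]/inr ->; rewrite ?orbT.
Qed.

(** The word of the right contour is c itself, up to the dart that names its
    starting vertex. *)
Lemma contractible_right : exists2 h, h \in right_contour &
  null_contour S h -> contractible M c.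
Proof.
case rE: right_contour => [|h L].
  by have := right_contour_word; rewrite rE; have /and4P[+ _ _ _] := cyc; case: (c).
exists h; first exact: mem_head.
have cE : contour S h = h :: L by apply: contour_cons; rewrite -rE right_contourP.
rewrite /null_contour cE -rE right_contour_word /contractible.
have := cycle_walk (_ : fcycle (contour_next S) (h :: L)).
rewrite -rE right_contour_word => /(_ right_contour_path) [wc _].
case: (c) wc => // x s; rewrite walk_cons => /andP[hx _].
exact: homotopy_vertex.
Qed.

End OneCycle.

(** The left side of a cycle is the right side of its reverse, so that only
    right contours need to be studied. *)
Section Reverse.
Variable c : seq D.
Hypothesis cyc : is_cycle M c.
Let c' := reverse_walk M c.

Lemma reverse_is_cycle : is_cycle M c'.
Proof.
have /and4P[nc cc _ _] := cyc; apply/and4P; split.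
- by rewrite /c' /reverse_walk -size_eq0 size_rev size_map size_eq0.
- rewrite /c' /reverse_walk rev_cycle cycle_map.
  apply: sub_cycle cc => a b /=; rewrite /consecutive edgeK.
  by rewrite same_vertex_sym.
- apply/allP=> x; rewrite /c' /reverse_walk !mem_rev => /mapP[z zc ->].
  apply/negP=> /mapP[z' z'c]; rewrite edgeK => zz'.
  by have := cycle_edge cyc z'c; rewrite -zz' zc.
have uc' : uniq c'.
  by rewrite /c' /reverse_walk rev_uniq (map_inj_uniq (@edge_inj _ M)) cycle_uniq.
move: uc'; rewrite uniq_pairwise.
apply: (sub_in_pairwise (P := fun z => z \in c')); last exact/allP.
have inc' z : z \in c' -> exists2 y, y \in c & z = e y.
  by rewrite /c' /reverse_walk mem_rev => /mapP.
move=> a b /inc'[z zc ->] /inc'[z' z'c ->] /=; apply: contraNN => zz'.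
have en y : y \in c -> same_vertex M (e y) (path.next c y).
  move=> yc; have := cycle_enter cyc (_ : path.next c y \in c).
  by rewrite mem_next prev_next ?cycle_uniq // yc => /(_ isT).
have : path.next c z = path.next c z'.
  apply: (cycle_vertex_inj cyc); rewrite ?mem_next //.
  apply: same_vertex_trans (en z' z'c); apply: same_vertex_trans zz'.
  by rewrite same_vertex_sym en.
by move/(congr1 (prev c)); rewrite !prev_next ?cycle_uniq // => ->.
Qed.

Lemma map_prev_perm : perm_eq [seq prev c x | x <- c] c.
Proof.
have uc := cycle_uniq cyc; apply: uniq_perm => //.
  rewrite map_inj_uniq //; exact: can_inj (next_prev uc).
move=> x; apply/mapP/idP => [[y yc ->]|xc]; first by rewrite mem_prev.
by exists (path.next c x); rewrite ?mem_next // prev_next.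
Qed.

Lemma gamma_reverse (w : D -> nat) : gamma_R M w c' = gamma_L M w c.
Proof.
have uc := cycle_uniq cyc.
rewrite /gamma_R /gamma_L /c' /reverse_walk (perm_big _ (permEl (perm_rev _))) /=.
rewrite big_map -(perm_big _ map_prev_perm) big_map big_seq [RHS]big_seq.
apply: eq_bigr => x xc; rewrite prev_rev; last by rewrite (map_inj_uniq (@edge_inj _ M)).
by rewrite (next_map (@edge_inj _ M)) // next_prev // edgeK.
Qed.

Lemma reverse_contractible : contractible M c' -> contractible M c.
Proof.
have /and4P[_ cc _ _] := cyc; rewrite /contractible /c'.
case cE: c cc => [//|x s] cc.
have /andP[wc ec] : walk M x (x :: s) && same_vertex M (walk_end M x (x :: s)) x.
  move: cc; rewrite /= rcons_path => /andP[ps ls].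
  by rewrite walk_cons same_vertex_refl /walk edgeK ps.
have [wr er] := walk_reverse wc.
case rE: (reverse_walk M (x :: s)) => [|a l].
  by move: (congr1 size rE); rewrite /reverse_walk size_rev.
move=> h; have ax : same_vertex M a x.
  apply: same_vertex_trans ec; rewrite same_vertex_sym.
  by move: wr; rewrite rE walk_cons => /andP[].
have {}h : homotopic M x (reverse_walk M (x :: s)) [::].
  by rewrite rE; apply: homotopy_vertex h.
have wr' : walk M x (reverse_walk M (x :: s)).
  by rewrite -(walk_vertex _ ec).
have [_ er'] := homotopic_walk h wr'; rewrite walk_end_nil in er'.
have := homotopy_inverse wr' _ h; rewrite same_vertex_sym er' => /(_ isT).
suff -> : reverse_walk M (reverse_walk M (x :: s)) = x :: s by [].
rewrite /reverse_walk map_rev revK -map_comp -[RHS]map_id.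
by apply: eq_map => y /=; rewrite edgeK.
Qed.

End Reverse.

(** The weights at the vertices of c amount to d for each of them, and the
    darts of c take d - 2 per edge; the remaining 2 per vertex lies on the two
    sides. *)
Lemma gamma_sum (d : nat) (w : D -> nat) c : (2 <= d)%N -> is_cycle M c ->
  (forall h, (w h + w (e h) = d - 2)%N) ->
  (forall h, (\sum_(y <- orbit N h) w y = d)%N) ->
  (gamma_R M w c + gamma_L M w c = 2 * size c)%N.
Proof.
move=> d2 cyc we wv.
have sumE : (\sum_(x <- c) w (e (prev c x)) = \sum_(x <- c) w (e x))%N.
  by rewrite -[RHS](perm_big _ (map_prev_perm cyc)) big_map.
have : (gamma_R M w c + gamma_L M w c + \sum_(x <- c) (d - 2) = \sum_(x <- c) d)%N.
  rewrite /gamma_R /gamma_L -big_split /=.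
  rewrite (eq_bigr (fun x => w x + w (e x))%N (fun x _ => esym (we x))).
  rewrite [X in (_ + X)%N]big_split /= -sumE -big_split -big_split /=.
  rewrite !big_seq; apply: eq_bigr => x xc.
  rewrite -(wv x) (sector_split (b := e (prev c x))).
  - by rewrite !big_cons big_cat big_cons /=; clear; lia.
  - by rewrite same_vertex_sym cycle_enter.
  - by rewrite eq_sym cycle_enter_neq.
rewrite !big_const_seq !count_predT !iter_addn_0.
by move: (gamma_R _ _ _) (gamma_L _ _ _) (size c) => r l k; move: d2; clear; nia.
Qed.

End Cycles.

(** * Nonnegative turnings on both sides give balance *)

Section Balance.
Variables (D : finType) (M : cmap D) (d : nat) (w : D -> nat).
Notation e := (edge M).
Hypothesis d2 : 2 <= d.
Let wz h : int := (w h)%:Z.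
Hypothesis ww : weighting M d wz.
Hypothesis tw : nonneg_or_disc M d wz.

Lemma size_le_gamma_R c : is_cycle M c -> ~ contractible M c ->
  size c <= gamma_R M w c.
Proof.
move=> cyc ncc; have [h hr hc] := contractible_right cyc.
have k := right_contour_turning cyc w hr.
have [|k0|[_ /hc //]] := tw (S := cycle_edges M c) (h := h).
  by move=> y yS; apply: right_contour_min hr.
by move: k0; rewrite k subr_ge0 lez_nat.
Qed.

Lemma weighting_edge h : w h + w (e h) = d - 2.
Proof. by have := ww.1 h; move: d2; rewrite /wz; clear; lia. Qed.

Lemma weighting_vertex h : \sum_(y <- orbit (next M) h) w y = d.
Proof.
apply/eqP; rewrite -eqz_nat -(ww.2 h); apply/eqP.
by rewrite -[LHS]natz natr_sum; apply: eq_bigr => y _; rewrite natz.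
Qed.

Lemma nonneg_or_disc_balanced : balanced M w.
Proof.
move=> c cyc ncc; have R := size_le_gamma_R cyc ncc.
have L : size c <= gamma_L M w c.
  rewrite -(gamma_reverse cyc w) -[size c](size_map e) -size_rev.
  apply: size_le_gamma_R; first exact: reverse_is_cycle.
  by move/(reverse_contractible cyc).
have := gamma_sum d2 cyc weighting_edge weighting_vertex.
by rewrite /gamma; move: R L; clear; lia.
Qed.

Lemma weighting_orientation : orientation_d_dm2 M w d.
Proof.
split=> [x|x]; last exact: weighting_edge.
rewrite -(weighting_vertex x) /vertex_weight big_uniq ?orbit_uniq //.
by apply: eq_bigl => y; rewrite same_vertexE fconnect_orbit.
Qed.

End Balance.

Theorem proposition8 (d : nat) (D : finType) (M : cmap D) :
  3 <= d -> toroidal M -> angulation M d -> has_essential_girth M d ->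
  exists w : D -> nat, orientation_d_dm2 M w d /\ balanced M w.
Proof.
move=> d3 [D0 conn eul] ang [x0 [_ girth]].
have euler : nverts M + nfaces M = nedges M := eul.
have [T tT] := exists_tree euler conn D0.
have [w0 [ww0 van0]] := exists_weights euler D0 ang tT.
have tri0 : nonneg_or_disc M d w0.
  move=> S h mi; apply: (contour_nonneg_or_disc euler conn D0 ang ww0) => // T' tT'.
  exact: vanishing_all tT tT' van0.
have [w1 [ww1 tri1 pos]] := exists_nonneg conn girth ww0 tri0.
pose w h := `|w1 h|%N.
have wE : (fun h => Posz (w h)) = w1.
  by apply/funext => h; rewrite /w gez0_abs.
have d2 : 2 <= d by apply: ltnW.
rewrite -wE in ww1 tri1; exists w; split.
  exact: weighting_orientation ww1.
exact: nonneg_or_disc_balanced ww1 tri1.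
Qed.
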